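(* Let $n\ge2$ and let $S\subset C(\mathbb S_{\mathbb R}^{n-1};\mathbb C)$ be a finite-dimensional subspace. Then the following assertions are equivalent: (1) $S$ is $\mathcal O_n$-invariant. (2) $S$ is $\mathcal O_n$-accessible. (3) There exists a finite set $F\subset\mathbb N_0$ such that $S=\bigoplus_{d\in F}\mathcal H_d\bigl(\mathbb S_{\mathbb R}^{n-1};\mathbb C\bigr)$.
   Context: $\mathbb S_{\mathbb R}^{n-1}=\{x\in\mathbb R^n:\|x\|_2=1\}$ with normalized rotation-invariant measure $\sigma_n$; the orthogonal group $\mathcal O_n$ acts by $A\bullet x=Ax$. $\mathcal H_d(\mathbb S_{\mathbb R}^{n-1};\mathbb C)$ is the space of restrictions to the sphere of complex-coefficient $d$-homogeneous polynomials on $\mathbb R^n$ annihilated by the real Laplacian. Put $(L_Af)(x)=f(A^{-1}x)$ for $A\in\mathcal O_n$. $S$ is $\mathcal O_n$-invariant if $L_A(S)\subset S$ for all $A\in\mathcal O_n$. A (bounded linear) projection $Q\colon C(\mathbb S_{\mathbb R}^{n-1};\mathbb C)\to S$ is equivariant if $QL_A=L_AQ$ for all $A$. A finite-dimensional $\mathcal O_n$-invariant subspace $S$ is $\mathcal O_n$-accessible if every equivariant projection $Q\colon C(\mathbb S_{\mathbb R}^{n-1};\mathbb C)\to S$ coincides with the restriction to $C(\mathbb S_{\mathbb R}^{n-1};\mathbb C)$ of the orthogonal projection $L_2(\mathbb S_{\mathbb R}^{n-1},\sigma_n;\mathbb C)\to S$. *)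

(* Defs.v *)
From HB Require Import structures.
From mathcomp Require Import all_boot all_order all_algebra finmap.
From mathcomp Require Import complex.
From mathcomp Require mpoly.
(* The notations of mpoly clash with those of the analysis library. *)
Import (canonicals, coercions) mpoly.
From mathcomp Require Import all_classical all_reals all_analysis.

Set Implicit Arguments.
Unset Strict Implicit.
Unset Printing Implicit Defensive.

Import Order.TTheory GRing.Theory Num.Theory.
Import numFieldNormedType.Exports.

Local Open Scope classical_set_scope.
Local Open Scope ring_scope.
Local Open Scope complex_scope.

Section continuous_lmodule.
Context {T : topologicalType} {K : numFieldType} {V : normedModType K}.
Implicit Types f g : continuousType T V.

Let add_continuous f g : continuous (fun x => f x + g x).
Proof. by move=> x; apply: cvgD; exact: cts_fun. Qed.

Let opp_continuous f : continuous (fun x => - f x).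
Proof. by move=> x; apply: cvgN; exact: cts_fun. Qed.

Let scale_continuous (a : K) f : continuous (fun x => a *: f x).
Proof. by move=> x; apply: cvgZr; exact: cts_fun. Qed.

Definition cts_zero : continuousType T V := cst 0.
Definition cts_add f g : continuousType T V := mkcts (@add_continuous f g).
Definition cts_opp f : continuousType T V := mkcts (@opp_continuous f).
Definition cts_scale (a : K) f : continuousType T V :=
  mkcts (@scale_continuous a f).

Let cts_addA : associative cts_add.
Proof. by move=> f g h; apply/continuousEP => x /=; exact: addrA. Qed.

Let cts_addC : commutative cts_add.
Proof. by move=> f g; apply/continuousEP => x /=; exact: addrC. Qed.

Let cts_add0 : left_id cts_zero cts_add.
Proof. by move=> f; apply/continuousEP => x /=; exact: add0r. Qed.

Let cts_addN : left_inverse cts_zero cts_opp cts_add.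
Proof. by move=> f; apply/continuousEP => x /=; exact: addNr. Qed.

HB.instance Definition _ := GRing.isZmodule.Build (continuousType T V)
  cts_addA cts_addC cts_add0 cts_addN.

Let cts_scaleA a b f : cts_scale a (cts_scale b f) = cts_scale (a * b) f.
Proof. by apply/continuousEP => x /=; exact: scalerA. Qed.

Let cts_scale1 : left_id 1 cts_scale.
Proof. by move=> f; apply/continuousEP => x /=; exact: scale1r. Qed.

Let cts_scaleDr : right_distributive cts_scale +%R.
Proof. by move=> a f g; apply/continuousEP => x /=; exact: scalerDr. Qed.

Let cts_scaleDl f : {morph cts_scale^~ f : a b / a + b}.
Proof. by move=> a b; apply/continuousEP => x /=; exact: scalerDl. Qed.

HB.instance Definition _ := GRing.Zmodule_isLmodule.Build K
  (continuousType T V) cts_scaleA cts_scale1 cts_scaleDr cts_scaleDl.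

End continuous_lmodule.

(* The Euclidean norm: the canonical norm `|x| of a matrix is the sup norm. *)
Definition norm2 (R : realType) (n : nat) (x : 'cV[R]_n) : R :=
  Num.sqrt (\sum_i x i 0 ^+ 2).

Definition unit_sphere (R : realType) (n : nat) : set 'cV[R]_n :=
  [set x | norm2 x = 1].

(* The unit sphere of R^n, i.e. S^(n-1). *)
Definition sphere (R : realType) (n : nat) : Type :=
  set_type (@unit_sphere R n).

HB.instance Definition _ (R : realType) (n : nat) :=
  Topological.copy (sphere R n) (set_type (@unit_sphere R n)).

Definition sphere_val (R : realType) (n : nat) (x : sphere R n) : 'cV[R]_n :=
  set_val x.

Lemma delta_on_sphere (R : realType) (n : nat) :
  (delta_mx 0 0 : 'cV[R]_n.+1) \in @unit_sphere R n.+1.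
Proof.
rewrite inE /unit_sphere /norm2 /= (bigD1 0) //= big1 => [|i i0].
  by rewrite mxE !eqxx expr1n addr0 sqrtr1.
by rewrite mxE (negbTE i0) expr0n.
Qed.

HB.instance Definition _ (R : realType) (n : nat) :=
  isPointed.Build (sphere R n.+1)
    (exist (fun x => x \in @unit_sphere R n.+1) _ (@delta_on_sphere R n)).

(* C(S^(n-1); C); the alias R[i]^o of R[i] carries the norm topology. *)
Notation csphere R n := (continuousType (sphere R n) R[i]^o).

Section orthogonal_action.
Context {R : realType} {n : nat}.

Definition orthogonal_mx : pred 'M[R]_n := [pred A | A^T *m A == 1%:M].

Definition orthogonal_group : Type := {A : 'M[R]_n | orthogonal_mx A}.

Lemma orthogonal_mx_unit (A : 'M[R]_n) : orthogonal_mx A -> A \in unitmx.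
Proof. by move/eqP/mulmx1_unit; case. Qed.

Lemma orthogonal_mx_inv (A : 'M[R]_n) :
  orthogonal_mx A -> orthogonal_mx (invmx A).
Proof.
move=> oA; have uA := orthogonal_mx_unit oA.
have -> : invmx A = A^T.
  by rewrite -[LHS]mul1mx -(eqP oA) -mulmxA mulmxV // mulmx1.
by rewrite /orthogonal_mx /= trmxK; apply/eqP/mulmx1C/eqP.
Qed.

Definition orthogonal_inv (A : orthogonal_group) : orthogonal_group :=
  exist _ (invmx (val A)) (orthogonal_mx_inv (valP A)).

Lemma norm2_orthogonal (A : orthogonal_group) (x : 'cV[R]_n) :
  norm2 (val A *m x) = norm2 x.
Proof.
have dot (y : 'cV[R]_n) : \sum_i y i 0 ^+ 2 = (y^T *m y : 'M[R]_1) 0 0.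
  by rewrite mxE; apply: eq_bigr => i _; rewrite mxE expr2.
rewrite /norm2 !dot trmx_mul mulmxA -(mulmxA x^T).
by have /eqP -> := valP A; rewrite mulmx1.
Qed.

Lemma sphere_act_subproof (A : orthogonal_group) (x : sphere R n) :
  (val A *m sphere_val x) \in @unit_sphere R n.
Proof.
by rewrite inE /unit_sphere /= norm2_orthogonal; have /set_mem := valP x.
Qed.

Definition sphere_act (A : orthogonal_group) (x : sphere R n) : sphere R n :=
  exist (fun y => y \in @unit_sphere R n) _ (sphere_act_subproof A x).

Lemma sphere_val_continuous : continuous (@sphere_val R n).
Proof. exact: initial_continuous. Qed.

Lemma mulmx_continuous (T : topologicalType) (A : 'M[R]_n) (f : T -> 'cV[R]_n) :
  continuous f -> continuous (fun x => A *m f x).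
Proof.
move=> cf x P [Q Qx sQP].
suff : \forall y \near x, forall ij : 'I_n * 'I_1,
    Q ij.1 ij.2 ((A *m f y) ij.1 ij.2).
  by apply: filterS => y Qy; apply: sQP => i j; exact: (Qy (i, j)).
apply: filter_forall => -[i j] /=.
have cij : continuous (fun y => (A *m f y) i j).
  under eq_fun do rewrite mxE.
  move=> y; apply: cvg_big => [|k _]; first exact: add_continuous.
  apply: cvgMl_tmp; apply: (@continuous_comp _ _ _ f (fun M => M k j)).
    exact: cf.
  exact: coord_continuous.
exact: (cij x _ (Qx i j)).
Qed.

Lemma sphere_act_continuous A : continuous (sphere_act A).
Proof.
exact: (@continuous_comp_initial _ _ _ (@set_val _ (@unit_sphere R n))
  (sphere_act A : sphere R n -> initial_topology _)
  (mulmx_continuous sphere_val_continuous)).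
Qed.

HB.instance Definition _ (A : orthogonal_group) :=
  isContinuous.Build _ _ (sphere_act A) (@sphere_act_continuous A).

Definition translate (A : orthogonal_group) (f : csphere R n) : csphere R n :=
  f \o sphere_act (orthogonal_inv A).

Definition orthogonal_invariant (S : set (csphere R n)) : Prop :=
  forall A : orthogonal_group, translate A @` S `<=` S.

End orthogonal_action.

Arguments orthogonal_group : clear implicits.

Section harmonics.
Context {R : realType} {n : nat}.

Definition laplacian (p : mpoly.mpoly n R[i]) : mpoly.mpoly n R[i] :=
  \sum_(i < n) mpoly.mderiv i (mpoly.mderiv i p).

(* The zero polynomial is d-homogeneous for every d. *)
Definition harmonics (d : nat) : set (csphere R n) :=
  [set f | exists p : mpoly.mpoly n R[i],
    [/\ p \is mpoly.ishomog1 d mpoly.mdeg,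
        laplacian p = 0
      & forall x : sphere R n,
          f x = mpoly.meval (fun i => (sphere_val x i 0)%:C) p]].

End harmonics.

Section linear_subspaces.
Context {K : fieldType} {V : lmodType K}.

Definition finite_dim_subspace (S : set V) : Prop :=
  submod_closed [in S] /\
  exists (m : nat) (b : 'I_m -> V), (forall i, S (b i)) /\
    forall f, S f -> exists c : 'I_m -> K, f = \sum_i c i *: b i.

(* S is the internal direct sum of the subspaces H d, d in F. *)
Definition is_direct_sum (F : {fset nat}) (H : nat -> set V) (S : set V) :
    Prop :=
  (forall f, S f <-> exists g : nat -> V,
     (forall d, d \in F -> H d (g d)) /\ f = \sum_(d <- F) g d) /\
  (forall g : nat -> V, (forall d, d \in F -> H d (g d)) ->
     \sum_(d <- F) g d = 0 -> forall d, d \in F -> g d = 0).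

End linear_subspaces.

Section projections.
Context {R : realType} {n : nat}.
Implicit Types (S : set (csphere R n)) (Q : {linear csphere R n -> csphere R n}).

Definition supnorm (f : csphere R n) : R :=
  sup [set ComplexField.Normc.normc (f x) | x in setT].

Definition bounded_operator Q : Prop :=
  exists M : R, forall f, supnorm (Q f) <= M * supnorm f.

Definition projection_onto S Q : Prop :=
  [/\ bounded_operator Q, forall f, S (Q f) & forall f, S f -> Q f = f].

Definition equivariant Q : Prop :=
  forall (A : orthogonal_group R n) f, Q (translate A f) = translate A (Q f).

End projections.

(* Measurable types have to be inhabited, hence the shift of the index: this is
   the unit sphere of R^(n+1). *)
Definition borel_sphere (R : realType) (n : nat) :=
  g_sigma_algebraType (@open (sphere R n.+1)).

Section accessibility.
Context {R : realType} {n : nat}.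
Implicit Types (sigma : probability (borel_sphere R n) R)
  (S : set (csphere R n.+1)).

(* There is exactly one rotation-invariant Borel probability on the sphere: the
   normalized surface measure. *)
Definition rotation_invariant sigma : Prop :=
  forall (A : orthogonal_group R n.+1) (B : set (borel_sphere R n)),
    measurable B -> sigma (sphere_act A @^-1` B) = sigma B.

Definition cintegral sigma (f : borel_sphere R n -> R[i]) : R[i] :=
  (\int[sigma]_(x in setT) complex.Re (f x)) +i* (\int[sigma]_(x in setT) complex.Im (f x)).

Definition l2_inner sigma (f g : borel_sphere R n -> R[i]) : R[i] :=
  cintegral sigma (fun x => f x * (g x)^*).

(* For f in L_2(sigma) and S finite-dimensional: g is the image of f under the
   orthogonal projection of L_2(sigma) onto S. *)
Definition is_l2_projection sigma S (f : borel_sphere R n -> R[i])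
    (g : csphere R n.+1) : Prop :=
  S g /\ forall h, S h -> l2_inner sigma (fun x => f x - g x) h = 0.

Definition orthogonal_accessible sigma S : Prop :=
  orthogonal_invariant S /\
  forall Q : {linear csphere R n.+1 -> csphere R n.+1},
    projection_onto S Q -> equivariant Q ->
    forall f : csphere R n.+1, is_l2_projection sigma S f (Q f).

End accessibility.

(* Main.v *)
Require Import Defs.
From HB Require Import structures.
From mathcomp Require Import all_boot all_order all_algebra finmap.
From mathcomp Require Import complex.
From mathcomp Require mpoly.
Import (canonicals, coercions) mpoly.
From mathcomp Require Import all_classical all_reals all_analysis.
From mathcomp Require Import ring lra zify.

Set Implicit Arguments.
Unset Strict Implicit.
Unset Printing Implicit Defensive.

Import Order.TTheory GRing.Theory Num.Theory.
Import numFieldNormedType.Exports.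

Local Open Scope classical_set_scope.
Local Open Scope ring_scope.
Local Open Scope complex_scope.

(* Any two points of the sphere are exchanged by an orthogonal reflection, so
   every kernel k(x, y) invariant under the orthogonal group is symmetric.  Apply
   this to k(x, y) = (T w_y)(x), where w_y(x) = w(<x, y>) is a polynomial zonal
   function and T is equivariant.  For the orthogonal projection T = P onto an
   invariant S, symmetry shows that y |-> <w_y, h> lies in S when h does.  For an
   equivariant projection T = Q, exchanging Q with the integral against the
   separable kernel w_y(x) then gives <Q w_y, h> = <w_y, h>.  The kernels
   ((1 + <x, y>) / 2)^m, normalized, form an approximate identity, so the zonal
   functions w_y are total in C(S^(n-1)) and Q = P.

   For the decomposition, the reproducing kernel of an invariant subspace W of H_d
   is a zonal function of H_d, hence a multiple of the zonal harmonic Z_d (the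
   Gegenbauer recursion has one solution up to scaling).  So the Z_d(., y) belong
   to W as soon as W <> 0, and H_d is irreducible; an invariant S either contains
   H_d or is orthogonal to all Z_d(., y), again because y |-> <Z_d(., y), h> lies
   in the intersection of S and H_d.  As the Z_d(., y) span the zonal
   polynomials, a vector of S orthogonal to every H_d contained in S vanishes. *)

(** * Orthogonal substitutions and the Laplacian *)

(** Nothing is used about [sigma] beyond its being an invariant probability. Averaging over the
    group is replaced by the symmetry of kernels, areas of caps by a covering argument, and the
    self-adjointness of the Laplacian by irreducibility together with the degree of the zonal
    polynomial. Reflections matter: on the circle, rotations alone split H_d, d > 0, into the lines
    of exp(i d t) and exp(- i d t).

    For h in S the function g(y) = <w_y, h> lies in S, so Q g = g. Writing g as the integral of
    conj(h(z)) w_z over z and applying Q inside, g(y) becomes the integral of (Q w_z)(y) conj(h(z));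
    symmetry turns (Q w_z)(y) into (Q w_y)(z), and the result is <Q w_y, h>. Since w(<z, y>) is a
    finite sum of products, moving Q under the integral is pure algebra; the boundedness of Q enters
    through the totality of the zonal functions. *)

Section mpoly_substitution.
Context {n : nat} {K : comNzRingType}.
Implicit Types (p q : mpoly.mpoly n K) (L : n.-tuple (mpoly.mpoly n K)).

Local Notation var i := (@mpoly.mpolyX n K (mpoly.mnm1 i)).
Local Notation D := mpoly.mderiv.
Local Notation subst L p := (mpoly.comp_mpoly L p).
Local Notation homog d p := (p \is mpoly.ishomog1 d mpoly.mdeg).

(** Polynomials are generated by the variables as an algebra, so identities between derivations or
    ring morphisms need only be checked on variables. *)
Lemma mpoly_algebra_ind (P : mpoly.mpoly n K -> Prop) :
  P 1 -> (forall i, P (var i)) ->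
  (forall c p q, P p -> P q -> P (c *: p + q)) ->
  (forall p q, P p -> P q -> P (p * q)) -> forall p, P p.
Proof.
move=> P1 PX Plin PM p.
have P0 : P 0 by have := Plin (-1) _ _ P1 P1; rewrite scaleN1r addNr.
have PZ c q : P q -> P (c *: q) by move=> Pq; rewrite -[_ *: _]addr0; exact: Plin.
rewrite (mpoly.mpolyE p); apply: big_rec => // m q _ Pq; apply: Plin => //.
rewrite mpoly.mpolyXE_id; elim/big_ind : _ => // i _.
by elim: (X in _ ^+ X) => [|k Pk]; rewrite ?expr0 ?exprS //; exact: PM.
Qed.

(** The chain rule. Both sides obey the same Leibniz rule along the substitution, so they agree as
    soon as they agree on variables. *)
Lemma mderiv_comp L p i :
  D i (subst L p) = \sum_k D i (tnth L k) * subst L (D k p).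
Proof.
elim/mpoly_algebra_ind: p => [|j|c p q Hp Hq|p q Hp Hq].
- rewrite mpoly.comp_mpoly1 -mpoly.mpolyC1 mpoly.mderivC big1 // => k _.
  by rewrite mpoly.mderivC mpoly.comp_mpoly0 mulr0.
- rewrite mpoly.comp_mpolyXU -tnth_nth (bigD1 j) //= big1 => [|k kj].
    rewrite mpoly.mderivX mpoly.mnmE eqxx scale1r addr0.
    rewrite (_ : mpoly.mnm_sub _ _ = mpoly.mnm0) //; last first.
      by apply/mpoly.mnmP => k; rewrite !mpoly.mnmE subnn.
    by rewrite mpoly.mpolyX0 mpoly.comp_mpoly1 mulr1.
  rewrite mpoly.mderivX mpoly.mnmE eq_sym (negbTE kj) scale0r.
  by rewrite mpoly.comp_mpoly0 mulr0.
- rewrite mpoly.comp_mpolyD mpoly.comp_mpolyZ mpoly.mderivD mpoly.mderivZ.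
  rewrite Hp Hq scaler_sumr -big_split /=; apply: eq_bigr => k _.
  rewrite mpoly.mderivD mpoly.mderivZ mpoly.comp_mpolyD mpoly.comp_mpolyZ.
  by rewrite mulrDr scalerAr.
- rewrite rmorphM /= mpoly.mderivM Hp Hq mulr_suml mulr_sumr -big_split /=.
  apply: eq_bigr => k _.
  rewrite mpoly.mderivM mpoly.comp_mpolyD !rmorphM /=.
  by rewrite mulrDr -mulrA; congr (_ + _); rewrite mulrCA.
Qed.

Lemma dhomog_bigprod (I : Type) (r : seq I) (e : I -> nat)
    (F : I -> mpoly.mpoly n K) :
  (forall i, homog (e i) (F i)) -> homog (\sum_(i <- r) e i)%N (\prod_(i <- r) F i).
Proof.
move=> H; elim: r => [|i r IH]; first by rewrite !big_nil; exact: mpoly.dhomog1.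
by rewrite !big_cons; exact: mpoly.dhomogM.
Qed.

Lemma dhomog_comp L d p : (forall i, homog 1 (tnth L i)) -> homog d p ->
  homog d (subst L p).
Proof.
move=> HL /mpoly.dhomogP Hp; rewrite mpoly.comp_mpolyEX big_seq.
elim/big_ind : _ => [|a b Ha Hb|m /Hp Hm]; first exact: mpoly.dhomog0.
  exact: mpoly.dhomogD.
apply: mpoly.dhomogZ; rewrite mpoly.comp_mpolyX -Hm /= mpoly.mdegE.
apply: dhomog_bigprod => i.
by rewrite -[X in mpoly.ishomog1 X]mul1n; apply: mpoly.dhomogMn.
Qed.

Definition linear_substitution (B : 'M[K]_n) : n.-tuple (mpoly.mpoly n K) :=
  mktuple (fun k : 'I_n => \sum_(l < n) B k l *: var l).

Lemma dhomog_var i : homog 1 (var i).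
Proof. by rewrite mpoly.dhomogX; apply/eqP; exact: mpoly.mdeg1. Qed.

Lemma mderiv_var i j : D i (var j) = (i == j)%:R%:A.
Proof.
rewrite mpoly.mderivX mpoly.mnmE eq_sym; have [<-|ij] := eqVneq i j; last first.
  by rewrite !scale0r.
rewrite (_ : mpoly.mnm_sub _ _ = mpoly.mnm0) ?mpoly.mpolyX0 //.
by apply/mpoly.mnmP => k; rewrite !mpoly.mnmE subnn.
Qed.

Lemma mderiv_linear_substitution (B : 'M[K]_n) i p :
  D i (subst (linear_substitution B) p) =
  \sum_k B k i *: subst (linear_substitution B) (D k p).
Proof.
rewrite mderiv_comp; apply: eq_bigr => k _; rewrite tnth_mktuple.
rewrite linear_sum (bigD1 i) //= big1 => [|l li].
  by rewrite mpoly.mderivZ mderiv_var eqxx scale1r addr0 -scalerAl mul1r.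
by rewrite mpoly.mderivZ mderiv_var eq_sym (negbTE li) scale0r scaler0.
Qed.

Lemma dhomog_linear_substitution (B : 'M[K]_n) d p :
  homog d p -> homog d (subst (linear_substitution B) p).
Proof.
apply: dhomog_comp => i; rewrite tnth_mktuple.
elim/big_ind : _ => [|a b Ha Hb|l _]; [exact: mpoly.dhomog0 | exact: mpoly.dhomogD |].
by apply: mpoly.dhomogZ; exact: dhomog_var.
Qed.

(** By the chain rule the second derivative in directions [k] and [l] gets the coefficient
    [\sum_i B k i * B l i], an entry of [B *m B^T]; only the diagonal survives. *)
Lemma laplacian_linear_substitution (B : 'M[K]_n) p : B *m B^T = 1%:M ->
  \sum_i D i (D i (subst (linear_substitution B) p)) =
  subst (linear_substitution B) (\sum_i D i (D i p)).
Proof.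
move=> HB.
under eq_bigr => i _.
  rewrite mderiv_linear_substitution linear_sum /=.
  under eq_bigr => k _.
    rewrite mpoly.mderivZ mderiv_linear_substitution scaler_sumr.
    under eq_bigr do rewrite scalerA.
    over.
  over.
rewrite exchange_big /= raddf_sum /=; apply: eq_bigr => k _.
rewrite exchange_big /= (bigD1 k) //= [X in _ + X]big1 ?addr0 => [|l lk].
  rewrite -scaler_suml; have /matrixP/(_ k k) := HB.
  rewrite !mxE eqxx => E; rewrite (_ : \sum_i _ = 1) ?scale1r // -[RHS]E.
  by apply: eq_bigr => i _; rewrite mxE.
rewrite -scaler_suml; have /matrixP/(_ k l) := HB.
rewrite !mxE eq_sym (negbTE lk) => E; rewrite (_ : \sum_i _ = 0) ?scale0r //.
by rewrite -[RHS]E; apply: eq_bigr => i _; rewrite mxE.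
Qed.

Lemma meval_linear_substitution (B : 'M[K]_n) (v : 'I_n -> K) p :
  mpoly.meval v (subst (linear_substitution B) p) =
  mpoly.meval (fun k => \sum_l B k l * v l) p.
Proof.
rewrite mpoly.comp_mpoly_meval; apply: mpoly.meval_eq => k.
rewrite tnth_mktuple (raddf_sum (mpoly.meval v)); apply: eq_bigr => l _ /=.
by rewrite mpoly.mevalZ mpoly.mevalXU.
Qed.

Lemma meval_dhomog d p (v : 'I_n -> K) c : homog d p ->
  mpoly.meval (fun i => c * v i) p = c ^+ d * mpoly.meval v p.
Proof.
move=> /mpoly.dhomogP Hp; rewrite !mpoly.mevalE mulr_sumr !big_seq.
apply: eq_bigr => m /Hp Hm; rewrite mulrCA; congr (_ * _).
under eq_bigr do rewrite exprMn.
by rewrite big_split /= -expr_sum -mpoly.mdegE Hm.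
Qed.

End mpoly_substitution.

(** * Polynomials vanishing on many points *)

Lemma poly_eq0_infinite_roots (K : idomainType) (q : {poly K}) (t : nat -> K) :
  injective t -> (forall k, root q (t k)) -> q = 0.
Proof.
move=> tinj tq; apply: (@roots_geq_poly_eq0 _ _ [seq t k | k <- iota 0 (size q)]).
- by apply/allP => _ /mapP[k _ ->].
- by rewrite map_inj_uniq // iota_uniq.
- by rewrite size_map size_iota.
Qed.

(** Uniqueness of base-[B] expansions, by reduction modulo [B]. It keeps the exponents of the
    Kronecker substitution distinct. *)
Lemma digits_inj (B n : nat) (a b : 'I_n -> nat) :
  (forall i, a i < B)%N -> (forall i, b i < B)%N ->
  (\sum_i a i * B ^ i = \sum_i b i * B ^ i)%N -> a =1 b.
Proof.
elim: n a b => [|n IH] a b Ha Hb; first by move=> _ [].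
have E (c : 'I_n.+1 -> nat) : (\sum_i c i * B ^ i =
    c ord0 + (\sum_(i < n) c (lift ord0 i) * B ^ i) * B)%N.
  rewrite big_ord_recl /= expn0 muln1 big_distrl /=; congr addn.
  by apply: eq_bigr => i _; rewrite /bump /= add1n expnSr mulnA.
rewrite !E => H.
have B0 : (0 < B)%N by apply: leq_ltn_trans (Ha ord0).
have h0 : a ord0 = b ord0.
  by move/(congr1 (modn^~ B)): H; rewrite ![(_ + _ * _)%N]addnC !modnMDl !modn_small.
have /(IH _ _) h : (\sum_(i < n) a (lift ord0 i) * B ^ i =
    \sum_(i < n) b (lift ord0 i) * B ^ i)%N.
  by move: H; rewrite h0 => /addnI/eqP; rewrite eqn_pmul2r // => /eqP.
move=> i; case: (unliftP ord0 i) => [j ->|-> //]; exact: h.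
Qed.

(* Kronecker substitution: [v i = t ^ B ^ i], with [B] above the degree,
   separates the monomials. *)
Lemma mpoly_eq0_meval (K : numDomainType) n (p : mpoly.mpoly n K) :
  (forall v : 'I_n -> nat, (forall i, 0 < v i)%N ->
     mpoly.meval (fun i => (v i)%:R) p = 0) -> p = 0.
Proof.
move=> H; set B := (mpoly.msize p).
pose e (m : mpoly.multinom n) := (\sum_i m i * B ^ i)%N.
pose q : {poly K} := \sum_(m <- mpoly.msupp p) mpoly.mcoeff m p *: 'X^(e m).
have q0 : q = 0.
  apply: (@poly_eq0_infinite_roots _ _ (fun k => k.+1%:R)) => [k l /eqP|k].
    by rewrite eqr_nat eqSS => /eqP.
  apply/eqP; rewrite -[RHS](H (fun i => k.+1 ^ B ^ i)%N) => [|i].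
    rewrite mpoly.mevalE /q horner_sum; apply: eq_bigr => m _.
    rewrite hornerZ hornerXn; congr (_ * _).
    rewrite /e -prodrXr; apply: eq_bigr => i _.
    by rewrite natrX -exprM mulnC.
  by rewrite expn_gt0.
apply/mpoly.mpolyP => m; rewrite mpoly.mcoeff0.
apply/eqP; apply: contraT; rewrite -mpoly.mcoeff_msupp => mp.
have lt_B (m' : mpoly.multinom n) i : m' \in mpoly.msupp p -> (m' i < B)%N.
  move=> /mpoly.msize_mdeg_lt; apply: leq_ltn_trans.
  by rewrite mpoly.mdegE (bigD1 i) //= leq_addr.
move/(congr1 (fun q : {poly K} => q`_(e m))): q0.
rewrite coef0 /q coef_sum (bigD1_seq m) ?mpoly.msupp_uniq //=.
rewrite coefZ coefXn eqxx mulr1 big_seq_cond big1 ?addr0 => [mp0|m' /andP[m'p mm']].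
  by move: mp; rewrite mpoly.mcoeff_msupp mp0 eqxx.
rewrite coefZ coefXn; case: eqP => [E|]; last by rewrite mulr0.
case/eqP: mm'; apply/mpoly.mnmP.
by apply: (@digits_inj B) => // i; apply: lt_B.
Qed.

(** * Axially symmetric harmonic polynomials *)

Section zonal_polynomials.
Context {n : nat} {K : numFieldType} (y : 'I_n.+2 -> K).
Hypothesis y1 : \sum_i y i ^+ 2 = 1.
Implicit Types (p q : mpoly.mpoly n.+2 K) (F : {poly K}).

Local Notation var i := (@mpoly.mpolyX n.+2 K (mpoly.mnm1 i)).
Local Notation D := mpoly.mderiv.
Local Notation homog d p := (p \is mpoly.ishomog1 d mpoly.mdeg).
Local Notation lap p := (\sum_i D i (D i p)).

Definition axis_form : mpoly.mpoly n.+2 K := \sum_(i < n.+2) y i *: var i.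

Definition norm_form : mpoly.mpoly n.+2 K := \sum_(i < n.+2) var i ^+ 2.

Local Notation tau := axis_form.
Local Notation rho := norm_form.

Lemma dhomog_axis_form : homog 1 tau.
Proof.
rewrite /tau; elim/big_ind : _ => [|a b Ha Hb|l _]; [exact: mpoly.dhomog0 | exact: mpoly.dhomogD |].
by apply: mpoly.dhomogZ; exact: dhomog_var.
Qed.

Lemma dhomog_norm_form : homog 2 rho.
Proof.
rewrite /rho; elim/big_ind : _ => [|a b Ha Hb|l _]; [exact: mpoly.dhomog0 | exact: mpoly.dhomogD |].
by rewrite expr2; apply: (@mpoly.dhomogM _ _ _ 1 _ 1); exact: dhomog_var.
Qed.

Lemma mderiv_exp p k i : D i (p ^+ k) = k%:R *: (p ^+ k.-1 * D i p).
Proof.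
elim: k => [|[|k] IH].
- by rewrite expr0 -mpoly.mpolyC1 mpoly.mderivC scale0r.
- by rewrite expr1 expr0 mul1r scale1r.
- rewrite exprS mpoly.mderivM IH /= -scalerAr mulrA -exprS mulrC.
  by rewrite -[in RHS](natr1 k.+1) scalerDl scale1r addrC.
Qed.

Lemma mderiv_sum (I : Type) (r : seq I) (F : I -> mpoly.mpoly n.+2 K) i :
  D i (\sum_(j <- r) F j) = \sum_(j <- r) D i (F j).
Proof. exact: linear_sum. Qed.

Lemma mderiv_axis_form i : D i tau = (y i)%:A.
Proof.
rewrite /tau linear_sum (bigD1 i) //= big1 => [|l li].
  by rewrite mpoly.mderivZ mderiv_var eqxx scale1r addr0.
by rewrite mpoly.mderivZ mderiv_var eq_sym (negbTE li) scale0r scaler0.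
Qed.

Lemma mderiv_norm_form i : D i rho = 2 *: var i.
Proof.
rewrite /rho linear_sum (bigD1 i) //= big1 => [|l li].
  rewrite mderiv_exp mderiv_var eqxx scale1r mulr1 expr1 addr0 //.
by rewrite mderiv_exp mderiv_var eq_sym (negbTE li) scale0r mulr0 scaler0.
Qed.

(** The gradients of tau and rho are y and 2x, so their scalar products are 1, 2 tau and 4 rho,
    while rho has Laplacian 2(n + 2). A truncated exponent such as [j.-1] at [j = 0] is harmless,
    because its coefficient vanishes there. *)
Lemma laplacian_axis_norm m j :
  lap (tau ^+ m * rho ^+ j) = (m * m.-1)%:R *: (tau ^+ m.-2 * rho ^+ j) +
    (2 * j * (2 * j + 2 * m + n))%:R *: (tau ^+ m * rho ^+ j.-1).
Proof.
have Dtr a b i : D i (tau ^+ a * rho ^+ b) =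
    (a%:R * y i) *: (tau ^+ a.-1 * rho ^+ b) +
    (2 * b)%:R *: (tau ^+ a * rho ^+ b.-1 * var i).
  rewrite mpoly.mderivM !mderiv_exp mderiv_axis_form mderiv_norm_form.
  rewrite -!(scalerAl, scalerAr) !scalerA mulr1 natrM (mulrC 2) mulrA.
  by [].
have step i : D i (D i (tau ^+ m * rho ^+ j)) =
    (m * m.-1)%:R *: ((y i ^+ 2) *: (tau ^+ m.-2 * rho ^+ j)) +
    (4 * m * j)%:R *: (tau ^+ m.-1 * rho ^+ j.-1 * (y i *: var i)) +
    (4 * j * j.-1)%:R *: (tau ^+ m * rho ^+ j.-2 * var i ^+ 2) +
    (2 * j)%:R *: (tau ^+ m * rho ^+ j.-1).
  rewrite Dtr mpoly.mderivD !mpoly.mderivZ [D i (_ * var i)]mpoly.mderivM !Dtr mderiv_var eqxx.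
  rewrite scale1r mulr1 -!mpoly.mul_mpolyC; ring.
under eq_bigr => i _ do rewrite step.
clear step Dtr.
rewrite !big_split /= -!scaler_sumr -scaler_suml y1 scale1r.
rewrite -!mulr_sumr -/tau -/rho sumr_const card_ord -!addrA; congr (_ + _).
case: j => [|j] /=; first by rewrite !muln0 !mul0n !scale0r !add0r.
have -> : (4 * m * j.+1)%:R *: (tau ^+ m.-1 * rho ^+ j * tau) =
    (4 * m * j.+1)%:R *: (tau ^+ m * rho ^+ j).
  case: m => [|m] /=; first by rewrite muln0 mul0n !scale0r.
  by rewrite mulrAC -exprSr.
have -> : (4 * j.+1 * j)%:R *: (tau ^+ m * rho ^+ j.-1 * rho) =
    (4 * j.+1 * j)%:R *: (tau ^+ m * rho ^+ j).
  case: j => [|j] /=; first by rewrite muln0 !scale0r.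
  by rewrite -mulrA -exprSr.
rewrite mulrnAr -(scaler_nat n.+2 (tau ^+ m * rho ^+ j)) scalerA -!scalerDl; congr (_ *: _).
by rewrite -!natrM -!natrD; congr (_%:R); lia.
Qed.

(** Exactly the condition for completing every monomial of [F] to degree [d] by powers of the
    quadratic form rho: [d - m] has to be even and nonnegative. *)
Definition parity_poly d F :=
  forall m, (d < m)%N || (odd m != odd d) -> F`_m = 0.

Definition homogenization d F : mpoly.mpoly n.+2 K :=
  \sum_(m < d.+1) F`_m *: (tau ^+ m * rho ^+ (d - m)./2).

(* Coefficient of [t ^ m] in [(1 - t^2) F'' - (n + 1) t F' + d (d + n) F],
   the Gegenbauer operator in dimension [n + 2]. *)
Definition gegenbauer_coef d F m : K :=
  ((d - m) * (d + m + n))%:R * F`_m + (m.+2 * m.+1)%:R * F`_m.+2.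

Lemma laplacian_homogenization d F : parity_poly d F ->
  lap (homogenization d F) =
  \sum_(m < d.+1) gegenbauer_coef d F m *: (tau ^+ m * rho ^+ (d - m)./2.-1).
Proof.
move=> pF.
pose g m := (F`_m * (m * m.-1)%:R) *: (tau ^+ m.-2 * rho ^+ (d - m)./2).
pose h m := (((d - m) * (d + m + n))%:R * F`_m) *:
  (tau ^+ m * rho ^+ (d - m)./2.-1).
have term (m : 'I_d.+1) : lap (F`_m *: (tau ^+ m * rho ^+ (d - m)./2)) = g m + h m.
  under eq_bigr do rewrite !mpoly.mderivZ.
  rewrite -scaler_sumr laplacian_axis_norm scalerDr !scalerA; congr (_ + _).
  (* For the wrong parity the half [(d - m)./2] is not exact, but the coefficient is zero. *)
  have [od|/negPn odd_md] := boolP (odd m != odd d).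
    by rewrite /h (pF m) ?od ?orbT // mul0r mulr0.
  have md := ltn_ord m.
  have -> : (2 * (d - m)./2 = d - m)%N by move: odd_md md; lia.
  have -> : (d - m + 2 * m = d + m)%N by move: md; lia.
  by rewrite /h mulrC.
rewrite /homogenization.
under eq_bigr => i _ do rewrite 2![D i (\sum_(m < d.+1) _)]mderiv_sum.
rewrite exchange_big /=; under eq_bigr do rewrite term.
rewrite big_split /=.
(* Shifting by 2 aligns the powers of tau: [g 0] and [g 1] vanish through the factor [m * m.-1], and
   [F] has no coefficient at [d.+1] and [d.+2]. *)
have -> : \sum_(m < d.+1) g m = \sum_(m < d.+1) g m.+2.
  have -> : \sum_(m < d.+1) g m = \sum_(m < d.+3) g m.
    rewrite [RHS]big_ord_recr [X in _ = X + _]big_ord_recr /=.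
    by rewrite /g !pF ?ltnS ?leqnn ?leqnSn // !mul0r !scale0r !addr0.
  rewrite big_ord_recl big_ord_recl /= {1 2}/g !muln0 !mulr0 !scale0r !add0r.
  by [].
rewrite addrC -big_split /=; apply: eq_bigr => m _.
rewrite /h /g /gegenbauer_coef scalerDl; congr (_ + _).
rewrite [F`_m.+2 * _]mulrC; congr (_ *: (_ * _ ^+ _)); lia.
Qed.

Lemma dhomog_homogenization d F : parity_poly d F -> homog d (homogenization d F).
Proof.
move=> pF; rewrite /homogenization.
elim/big_ind : _ => [|a b Ha Hb|m _]; [exact: mpoly.dhomog0 | exact: mpoly.dhomogD |].
have [/eqP|odd_md] := boolP (odd m == odd d); last first.
  by rewrite pF ?odd_md ?orbT // scale0r; exact: mpoly.dhomog0.
move=> odd_md; apply: mpoly.dhomogZ.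
have e : (1 * m + 2 * (d - m)./2 = d)%N by have := ltn_ord m; move: odd_md; lia.
rewrite -[X in mpoly.ishomog1 X]e.
apply: mpoly.dhomogM; apply: mpoly.dhomogMn;
  [exact: dhomog_axis_form | exact: dhomog_norm_form].
Qed.

Lemma meval_axis_form v : mpoly.meval v tau = \sum_i y i * v i.
Proof.
rewrite /tau (raddf_sum (mpoly.meval v)); apply: eq_bigr => i _ /=.
by rewrite mpoly.mevalZ mpoly.mevalXU.
Qed.

Lemma meval_norm_form v : mpoly.meval v rho = \sum_i v i ^+ 2.
Proof.
rewrite /rho (raddf_sum (mpoly.meval v)); apply: eq_bigr => i _ /=.
by rewrite rmorphXn /= mpoly.mevalXU.
Qed.

Lemma meval_homogenization d F v : parity_poly d F -> \sum_i v i ^+ 2 = 1 ->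
  mpoly.meval v (homogenization d F) = F.[(\sum_i y i * v i)].
Proof.
move=> pF v1.
have sF : (size F <= d.+1)%N by apply/leq_sizeP => m dm; rewrite pF ?dm.
rewrite (horner_coef_wide _ sF) /homogenization (raddf_sum (mpoly.meval v)).
apply: eq_bigr => m _ /=; rewrite mpoly.mevalZ rmorphM !rmorphXn /=.
by rewrite meval_axis_form meval_norm_form v1 expr1n mulr1.
Qed.

(** On unit vectors rho is 1, so the Laplacian restricts to a univariate polynomial in <y, v>. The
    family [v] supplies infinitely many roots. *)
Lemma gegenbauer_coef_eq0 d F : parity_poly d F -> lap (homogenization d F) = 0 ->
  (exists2 v : nat -> 'I_n.+2 -> K, (forall k, \sum_i v k i ^+ 2 = 1) &
     injective (fun k => \sum_i y i * v k i)) ->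
  forall m, (m <= d)%N -> gegenbauer_coef d F m = 0.
Proof.
move=> pF + [v v1 vinj] m md; rewrite laplacian_homogenization // => L0.
have : \poly_(m < d.+1) gegenbauer_coef d F m = 0.
  apply: (@poly_eq0_infinite_roots K _ _ vinj) => k; apply/rootP.
  move/(congr1 (mpoly.meval (v k))): L0; rewrite mpoly.meval0 => E; rewrite -[RHS]E.
  rewrite horner_poly (raddf_sum (mpoly.meval (v k))).
  apply: eq_bigr => l _ /=; rewrite mpoly.mevalZ rmorphM !rmorphXn /=.
  by rewrite meval_axis_form meval_norm_form v1 expr1n mulr1.
by move/(congr1 (fun F : {poly K} => F`_m)); rewrite coef0 coef_poly ltnS md.
Qed.

End zonal_polynomials.

(** * Gegenbauer polynomials *)

Section gegenbauer.
Context {n : nat} {K : numFieldType}.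
Implicit Types (F : {poly K}) (d : nat).

(** The recursion runs downwards: the coefficient at [m.+2] determines the one at [m], because
    [(d - m) * (d + m + n)] is nonzero for [m < d]. It starts from zero at [d] by hypothesis and at
    [d - 1] by parity. *)
Lemma gegenbauer_coef_uniq d F : (forall m, (m <= d)%N -> @gegenbauer_coef n K d F m = 0) ->
  parity_poly d F -> F`_d = 0 -> F = 0.
Proof.
move=> L0 pF Fd; apply/polyP => m; rewrite coef0.
suff H k : (k <= d)%N -> F`_(d - k) = 0.
  have [dm|md] := ltnP d m; first by rewrite pF ?dm.
  by rewrite -(subKn md) H // leq_subr.
elim/ltn_ind: k => -[_ _|[_ d0|k IH kd]].
- by rewrite subn0.
- by rewrite pF //; apply/orP; right; move: d0; lia.
have := L0 (d - k.+2)%N (leq_subr _ _); rewrite /gegenbauer_coef.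
have -> : (d - k.+2).+2 = (d - k)%N by lia.
rewrite (_ : F`_(d - k) = 0) ?mulr0 ?addr0; last by apply: IH; lia.
move=> /eqP; rewrite mulf_eq0 pnatr_eq0.
by case/orP => [|/eqP//]; rewrite muln_eq0 => H; exfalso; move: H kd; lia.
Qed.

(* [gegenbauer_seq d k] is the coefficient of [t ^ (d - k)]. *)
Fixpoint gegenbauer_seq d k : K :=
  match k with
  | 0 => 1
  | 1 => 0
  | k'.+2 => - ((d - k') * (d - k').-1)%:R /
             (k * (d + (d - k) + n))%:R * gegenbauer_seq d k'
  end.

(** The monic multiple of the Gegenbauer polynomial of index n/2, hence of the Chebyshev polynomial
    for [n = 0] and of the Legendre polynomial for [n = 1]. *)
Definition gegenbauer d : {poly K} := \poly_(m < d.+1) gegenbauer_seq d (d - m).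

Lemma gegenbauer_seq_odd d k : odd k -> gegenbauer_seq d k = 0.
Proof.
elim/ltn_ind: k => -[//|[//|k]] IH /= ok.
by rewrite IH ?mulr0 //; move: ok; rewrite negbK.
Qed.

Lemma parity_gegenbauer d : parity_poly d (gegenbauer d).
Proof.
move=> m; rewrite coef_poly ltnS; case: leqP => //= md odd_md.
by rewrite gegenbauer_seq_odd //; move: md odd_md; lia.
Qed.

Lemma coef_gegenbauer d : (gegenbauer d)`_d = 1.
Proof. by rewrite coef_poly ltnSn subnn. Qed.

Lemma gegenbauer_coef0 d m : (m <= d)%N -> @gegenbauer_coef n K d (gegenbauer d) m = 0.
Proof.
move=> md; rewrite /gegenbauer_coef.
have [d2m|m2d] := ltnP d m.+2.
  rewrite (parity_gegenbauer (m := m.+2)) ?d2m // mulr0 addr0.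
  have [->|dm] := eqVneq m d; first by rewrite subnn mul0r.
  by rewrite parity_gegenbauer ?mulr0 //; apply/orP; right; move: dm md d2m; lia.
rewrite !coef_poly !ltnS md m2d.
have -> : (d - m = (d - m.+2).+2)%N by lia.
set k := (d - m.+2)%N; rewrite [gegenbauer_seq d _.+2]/=.
have -> : (d - k = m.+2)%N by rewrite /k; lia.
have -> : (d - k.+2 = m)%N by rewrite /k; lia.
rewrite mulrA mulrCA mulfV ?mulr1 ?mulNr ?addNr //.
by rewrite pnatr_eq0 muln_eq0; rewrite /k; move: m2d; lia.
Qed.

End gegenbauer.

(** * Reflections of the sphere *)

Section sphere_geometry.
Context {R : realType} {n : nat}.
Implicit Types (x y z : sphere R n) (A : orthogonal_group R n).

Definition dot x y : R := \sum_i sphere_val x i 0 * sphere_val y i 0.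

Lemma sphere_val_inj : injective (@sphere_val R n).
Proof. by move=> x y; exact: val_inj. Qed.

Lemma dotC x y : dot x y = dot y x.
Proof. by apply: eq_bigr => i _; rewrite mulrC. Qed.

Lemma sphere_sumsq x : \sum_i sphere_val x i 0 ^+ 2 = 1.
Proof.
have /set_mem : sphere_val x \in @unit_sphere R n by exact: valP.
rewrite /unit_sphere /norm2 /= => /(congr1 (fun a => a ^+ 2)).
by rewrite sqr_sqrtr ?expr1n // sumr_ge0 // => i _; exact: sqr_ge0.
Qed.

Lemma dotxx x : dot x x = 1.
Proof. by rewrite -(sphere_sumsq x). Qed.

Lemma dist_dot x y :
  \sum_i (sphere_val x i 0 - sphere_val y i 0) ^+ 2 = 2 - 2 * dot x y.
Proof.
have -> : 2 - 2 * dot x y = dot x x + dot y y - 2 * dot x y by rewrite !dotxx.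
rewrite /dot mulr_sumr -big_split -sumrB /=.
by apply: eq_bigr => i _; ring.
Qed.

Lemma dot_le1 x y : dot x y <= 1.
Proof.
have : 0 <= 2 - 2 * dot x y.
  by rewrite -dist_dot sumr_ge0 // => i _; exact: sqr_ge0.
lra.
Qed.

Lemma dot_geN1 x y : -1 <= dot x y.
Proof.
have : 0 <= 2 + 2 * dot x y.
  have -> : 2 + 2 * dot x y =
      \sum_i (sphere_val x i 0 + sphere_val y i 0) ^+ 2.
    have -> : 2 + 2 * dot x y = dot x x + dot y y + 2 * dot x y by rewrite !dotxx.
    rewrite /dot mulr_sumr -!big_split /=.
    by apply: eq_bigr => i _; ring.
  by rewrite sumr_ge0 // => i _; exact: sqr_ge0.
lra.
Qed.

Lemma dot_eq1 x y : dot x y = 1 -> x = y.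
Proof.
move=> d1; apply/sphere_val_inj/colP => i.
have /eqP := dist_dot x y; rewrite d1 mulr1 subrr psumr_eq0 => [|j _].
  by move=> /allP/(_ i (mem_index_enum i)); rewrite sqrf_eq0 subr_eq0 => /eqP.
exact: sqr_ge0.
Qed.

Lemma dot_mx x y : dot x y = ((sphere_val x)^T *m sphere_val y) 0 0.
Proof. by rewrite mxE; apply: eq_bigr => i _; rewrite mxE. Qed.

Lemma sphere_val_act A x : sphere_val (sphere_act A x) = val A *m sphere_val x.
Proof. by []. Qed.

Lemma dot_act A x y : dot (sphere_act A x) (sphere_act A y) = dot x y.
Proof.
rewrite !dot_mx !sphere_val_act trmx_mul mulmxA -(mulmxA _ _ (val A)).
by have /eqP -> := valP A; rewrite mulmx1.
Qed.

Lemma sphere_act_invK A : cancel (sphere_act (orthogonal_inv A)) (sphere_act A).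
Proof.
move=> x; apply: sphere_val_inj; rewrite !sphere_val_act mulmxA mulmxV ?mul1mx //.
exact: orthogonal_mx_unit (valP A).
Qed.

Lemma sphere_actK A : cancel (sphere_act A) (sphere_act (orthogonal_inv A)).
Proof.
move=> x; apply: sphere_val_inj; rewrite !sphere_val_act mulmxA mulVmx ?mul1mx //.
exact: orthogonal_mx_unit (valP A).
Qed.

Lemma orthogonal_inv_inv A x :
  sphere_act (orthogonal_inv (orthogonal_inv A)) x = sphere_act A x.
Proof. by apply: (can_inj (sphere_actK (orthogonal_inv A))); rewrite sphere_act_invK sphere_actK. Qed.

Lemma dot_act_inv A x y : dot (sphere_act (orthogonal_inv A) x) y = dot x (sphere_act A y).
Proof. by rewrite -(dot_act A) sphere_act_invK. Qed.

(* The reflection in the hyperplane orthogonal to [x - y]. *)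
Lemma sphere_swap x y : exists A,
  [/\ sphere_act A x = y, sphere_act A y = x &
      forall z, dot z x = dot z y -> sphere_act A z = z].
Proof.
have [->|xy] := eqVneq x y.
  have o1 : orthogonal_mx (1%:M : 'M[R]_n) by rewrite /orthogonal_mx /= trmx1 mulmx1.
  pose A1 : orthogonal_group R n := exist (fun B : 'M[R]_n => orthogonal_mx B) _ o1.
  have E z : sphere_act A1 z = z.
    by apply: sphere_val_inj; rewrite sphere_val_act mul1mx.
  by exists A1; split => // z _; exact: E.
set v := sphere_val x - sphere_val y.
set s := 2 - 2 * dot x y.
have vv : v^T *m v = s%:M.
  apply/matrixP => i j; rewrite !ord1 /s -dist_dot mxE [RHS]mxE eqxx mulr1n.
  by apply: eq_bigr => k _; rewrite !mxE -expr2.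
have s0 : s != 0.
  apply: contra xy; rewrite /s subr_eq0 => /eqP s0; apply/eqP/dot_eq1.
  by lra.
pose M : 'M[R]_n := 1%:M - (2 / s) *: (v *m v^T).
have MT : M^T = M.
  by rewrite /M linearB /= trmx1 linearZ /= trmx_mul trmxK.
have oM : orthogonal_mx M.
  rewrite /orthogonal_mx /= MT /M mulmxBl mul1mx mulmxBr mulmx1.
  rewrite -scalemxAl -scalemxAr scalerA mulmxA -(mulmxA v) vv mul_mx_scalar.
  rewrite -scalemxAl scalerA.
  have -> : 2 / s * (2 / s) * s = 2 / s + 2 / s by field.
  by rewrite scalerDl; apply/eqP/matrixP => i j; rewrite !mxE; ring.
pose A : orthogonal_group R n := exist (fun B : 'M[R]_n => orthogonal_mx B) M oM.
have actE z : sphere_val (sphere_act A z) =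
    sphere_val z - (2 / s * (dot z x - dot z y)) *: v.
  rewrite sphere_val_act mulmxBl mul1mx -scalemxAl -mulmxA.
  have -> : v^T *m sphere_val z = (dot z x - dot z y)%:M.
    apply/matrixP => i j; rewrite !ord1 [RHS]mxE eqxx mulr1n mxE.
    rewrite -sumrB; apply: eq_bigr => k _.
    by rewrite !mxE; ring.
  by rewrite mul_mx_scalar scalerA.
exists A; split.
- apply: sphere_val_inj; rewrite actE dotxx (_ : _ * _ = 1) ?scale1r /v ?subKr //.
  by rewrite /s; move: s0; rewrite /s => s0; field.
- apply: sphere_val_inj; rewrite actE dotxx (dotC y x) (_ : _ * _ = -1).
    by rewrite scaleN1r opprK /v addrC subrK.
  by rewrite /s; move: s0; rewrite /s => s0; field.
- by move=> z zxy; apply: sphere_val_inj; rewrite actE zxy subrr mulr0 scale0r subr0.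
Qed.

Lemma sphere_transitive x y : exists A, sphere_act A x = y.
Proof. by have [A []] := sphere_swap x y; exists A. Qed.

Lemma translateE A (f : csphere R n) x :
  translate A f x = f (sphere_act (orthogonal_inv A) x).
Proof. by []. Qed.

Lemma invariant_kernelC (T : Type) (k : sphere R n -> sphere R n -> T) :
  (forall A x y, k (sphere_act A x) (sphere_act A y) = k x y) ->
  forall x y, k x y = k y x.
Proof.
by move=> kA x y; have [A [Ax Ay _]] := sphere_swap x y; rewrite -(kA A x y) Ax Ay.
Qed.

End sphere_geometry.

(** * Compactness and uniform continuity *)

Section sphere_topology.
Context {R : realType} {n : nat}.
Local Notation X := (sphere R n).

Lemma continuous_coordinate (i : 'I_n) : continuous (fun x : X => sphere_val x i 0).
Proof.
move=> x; apply: (@continuous_comp _ _ _ (@sphere_val R n) (fun M => M i 0)).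
  exact: sphere_val_continuous.
exact: coord_continuous.
Qed.

Lemma continuous_real_sum (T : topologicalType) (I : Type) (r : seq I) (f : I -> T -> R) :
  (forall i, continuous (f i)) -> continuous (fun x => \sum_(i <- r) f i x).
Proof.
move=> cf x; apply: cvg_big => [|i _]; first exact: add_continuous.
exact: cf.
Qed.

Lemma continuous_real_mul (T : topologicalType) (f g : T -> R) :
  continuous f -> continuous g -> continuous (fun x => f x * g x).
Proof. by move=> cf cg x; apply: cvgM; [exact: cf | exact: cg]. Qed.

Lemma continuous_real_add (T : topologicalType) (f g : T -> R) :
  continuous f -> continuous g -> continuous (fun x => f x + g x).
Proof. by move=> cf cg x; apply: cvgD; [exact: cf | exact: cg]. Qed.

Lemma continuous_real_scale (T : topologicalType) (a : R) (f : T -> R) :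
  continuous f -> continuous (fun x => a * f x).
Proof. by apply: continuous_real_mul; exact: cst_continuous. Qed.

Lemma continuous_real_norm (T : topologicalType) (f : T -> R) :
  continuous f -> continuous (fun x => `|f x|).
Proof. by move=> cf x; apply: cvg_norm; exact: cf. Qed.

Lemma continuous_dot2 : continuous (fun p : X * X => dot p.1 p.2).
Proof.
apply: continuous_real_sum => i; apply: continuous_real_mul => p.
  apply: (@continuous_comp _ _ _ (fst : X * X -> X) (fun x : X => sphere_val x i 0)).
    exact: cvg_fst.
  exact: continuous_coordinate.
apply: (@continuous_comp _ _ _ (snd : X * X -> X) (fun x : X => sphere_val x i 0)).
  exact: cvg_snd.
exact: continuous_coordinate.
Qed.

Lemma continuous_dot (y : X) : continuous (fun x : X => dot x y).
Proof.
apply: continuous_real_sum => i; apply: continuous_real_mul; last exact: cst_continuous.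
exact: continuous_coordinate.
Qed.

Lemma continuous_mx (T : topologicalType) (m p : nat) (f : T -> 'M[R]_(m, p)) :
  (forall i j, continuous (fun x => f x i j)) -> continuous f.
Proof.
move=> cf x P [Q Qx sQP].
suff : \forall y \near x, forall ij : 'I_m * 'I_p, Q ij.1 ij.2 ((f y) ij.1 ij.2).
  by apply: filterS => y Qy; apply: sQP => i j; exact: (Qy (i, j)).
by apply: filter_forall => -[i j] /=; exact: (cf i j x _ (Qx i j)).
Qed.

Lemma compact_unit_sphere : compact (@unit_sphere R n).
Proof.
(* Heine-Borel is applied to row vectors; the sphere is the image of a compact set under
   transposition. *)
pose tr (r : 'rV[R]_n) : 'cV[R]_n := r^T.
have ctr : continuous tr.
  apply: continuous_mx => i j; under eq_fun do rewrite mxE.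
  exact: coord_continuous.
pose N (r : 'rV[R]_n) : R := \sum_i r 0 i ^+ 2.
have cN : continuous N.
  apply: continuous_real_sum => i; under eq_fun do rewrite expr2.
  by apply: continuous_real_mul; exact: coord_continuous.
have -> : @unit_sphere R n = tr @` [set r | N r = 1].
  have E (r : 'rV[R]_n) : norm2 (tr r) = Num.sqrt (N r).
    by congr Num.sqrt; apply: eq_bigr => i _; rewrite mxE.
  apply/seteqP; split => [x /= nx|_ [r /= Nr <-]].
    exists x^T; last by rewrite /tr trmxK.
    move: nx; rewrite /unit_sphere /= -[in X in X -> _](trmxK x) E.
    move=> /(congr1 (fun a => a ^+ 2)); rewrite expr1n sqr_sqrtr //.
    by apply: sumr_ge0 => i _; exact: sqr_ge0.
  by rewrite /unit_sphere /= E Nr sqrtr1.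
apply: continuous_compact; first exact: continuous_subspaceT.
apply: bounded_closed_compact; last first.
  rewrite (_ : [set r | N r = 1] = N @^-1` [set 1]) //.
  by apply: (proj1 (continuous_closedP N)) => //; exact: closed_eq.
exists 1; split => [//|M M1 r /= Nr].
rewrite (le_trans _ (ltW M1)) // [leLHS]mx_normrE.
apply/bigmax_leP; split => // -[i j] _ /=; rewrite ord1.
rewrite -(@ler_sqr _ `|r 0 j| 1) ?nnegrE // expr1n real_normK ?num_real //.
rewrite -Nr /N (bigD1 j) //= lerDl.
by apply: sumr_ge0 => k _; exact: sqr_ge0.
Qed.

Lemma compact_sphere : compact [set: X].
Proof.
move=> F PF _.
have PG : ProperFilter (@sphere_val R n @ F) by exact: fmap_proper_filter.
have [|p [Sp clp]] := @compact_unit_sphere _ PG.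
  apply: (@filterS _ F _ setT) => [x _|]; last exact: filterT.
  exact: (set_mem (valP x)).
have Sp' : p \in @unit_sphere R n by rewrite inE.
exists (exist (fun y => y \in @unit_sphere R n) p Sp'); split => // A B FA.
move=> [_ [[U oU <-] /= Up] UB].
have [||q [[x Ax <-] Uq]] := clp (@sphere_val R n @` A) U.
- by apply: (@filterS _ F _ A) => // x Ax; exists x.
- exact: open_nbhs_nbhs.
by exists x; split => //; exact: UB.
Qed.

(** Compactness of the product reduces this to neighbourhoods of pairs. Near the diagonal [u] varies
    little; near a pair with [x != y] the scalar product stays below the midpoint of [dot x y] and
    1, so that [1 - d < dot x y] fails for small [d]. *)
Lemma uniform_continuity_dot (u : X -> R) (e : R) : continuous u -> 0 < e ->
  exists2 d : R, 0 < d & forall x y, 1 - d < dot x y -> `|u x - u y| < e.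
Proof.
move=> cu e0.
have /compact_near_coveringP cov : compact ([set: X] `*` [set: X]).
  by apply: compact_setX; exact: compact_sphere.
have := cov R (0^'+) (fun d (p : X * X) => 1 - d < dot p.1 p.2 -> `|u p.1 - u p.2| < e) _.
case=> [[x y] _ /=|]; last first.
  move=> r /= r0 H; exists (r / 2); first by rewrite divr_gt0.
  move=> x y; have := H (r / 2) _ _ (x, y); apply => //=.
    by rewrite sub0r normrN gtr0_norm ?divr_gt0 // ltr_pdivrMr // mulr2n mulrDr mulr1 ltrDl.
  by rewrite divr_gt0.
have [xy|xy] := eqVneq x y.
  have cv : continuous (fun p : X * X => `|u p.1 - u p.2|).
    move=> p; apply: cvg_norm; apply: cvgB.
      apply: (@continuous_comp _ _ _ (fst : X * X -> X) u); first exact: cvg_fst.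
      exact: cu.
    apply: (@continuous_comp _ _ _ (snd : X * X -> X) u); first exact: cvg_snd.
    exact: cu.
  have := cv (x, y) [set t | t < e]; rewrite /= xy subrr normr0.
  move=> /(_ (open_nbhs_nbhs _)) H.
  have {}H : \forall p \near (y, y), `|u p.1 - u p.2| < e.
    by apply: H; split => //; exact: open_lt.
  near=> p d => _ /=; near: p; exact: H.
have dxy : dot x y < 1.
  by rewrite lt_neqAle dot_le1 andbT; apply: contra xy => /eqP/dot_eq1/eqP.
have H : \forall p \near (x, y), dot p.1 p.2 < (1 + dot x y) / 2.
  apply: (@continuous_dot2 (x, y) [set t | t < (1 + dot x y) / 2]).
  apply: open_nbhs_nbhs; split => /=; first exact: open_lt.
  by lra.
exists ([set p : X * X | dot p.1 p.2 < (1 + dot x y) / 2], [set d | d < (1 - dot x y) / 2]) => /=.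
  split; first exact: H.
  by apply: nbhs_right_lt; lra.
move=> [p d] /= [H1 H2] H3; exfalso; lra.
Unshelve. all: by end_near.
Qed.

Lemma continuous_sphere_bounded (u : X -> R) : continuous u ->
  exists2 C : R, 0 < C & forall x, `|u x| <= C.
Proof.
move=> cu.
have /compact_bounded [M [_ HM]] : compact (u @` [set: X]).
  by apply: continuous_compact compact_sphere; exact: continuous_subspaceT.
exists (`|M| + 1) => [|x]; first by rewrite ltr_wpDl.
by apply: HM; [rewrite ltr_pwDr // ler_norm | exists x].
Qed.

End sphere_topology.

(** * The invariant mean and an approximate identity *)

Section sphere_integral.
Context {R : realType} {n : nat}.
Variable sigma : probability (borel_sphere R n) R.
Hypothesis sigma_inv : rotation_invariant sigma.
Local Notation X := (sphere R n.+1).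
Local Notation T := (borel_sphere R n).
Implicit Types (u v : X -> R) (x y : X).

Definition mean u : R := (\int[sigma]_(x in [set: T]) u x)%R.

Lemma measurable_continuous u : continuous u -> measurable_fun [set: T] (u : T -> R).
Proof.
move=> cu; apply: (measurability _ (measurable_realfun.RGenOInfty.measurableE R)) => _ [_ [a ->] <-].
rewrite setTI; apply: sub_sigma_algebra.
move/continuousP: cu => cu; by apply: cu; exact: interval_open.
Qed.

Lemma sphere_integrable u : continuous u -> sigma.-integrable [set: T] (EFin \o u).
Proof.
move=> cu; apply: (measurable_bounded_integrable (f := u : T -> R)) => //.
- by rewrite [X in (X < _)%E](probability_setT sigma) ltry.
- exact: measurable_continuous.
have [C C0 HC] := continuous_sphere_bounded cu.
exists C; split; first exact: num_real.
by move=> M CM x _ /=; apply: le_trans (HC x) (ltW CM).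
Qed.

Lemma meanD u v : continuous u -> continuous v ->
  mean (fun x => u x + v x) = mean u + mean v.
Proof. by move=> cu cv; apply: RintegralD => //; exact: sphere_integrable. Qed.

Lemma meanZ a u : continuous u -> mean (fun x => a * u x) = a * mean u.
Proof. by move=> cu; apply: RintegralZl => //; exact: sphere_integrable. Qed.

Lemma mean_le u v : continuous u -> continuous v -> (forall x, u x <= v x) ->
  mean u <= mean v.
Proof. by move=> cu cv uv; apply: le_Rintegral => //; exact: sphere_integrable. Qed.

Lemma mean_cst a : mean (fun=> a) = a.
Proof. by rewrite /mean Rintegral_cst // [X in fine X](probability_setT sigma) mulr1. Qed.

Lemma mean_ext u v : u =1 v -> mean u = mean v.
Proof. by move=> uv; apply: eq_Rintegral => x _; exact: uv. Qed.

Lemma mean_norm_le u C : continuous u -> (forall x, `|u x| <= C) -> `|mean u| <= C.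
Proof.
move=> cu uC; rewrite ler_norml; apply/andP; split.
  rewrite -(mean_cst (- C)); apply: mean_le => //; first exact: cst_continuous.
  by move=> x; have := uC x; rewrite ler_norml => /andP[].
rewrite -[leRHS](mean_cst C); apply: mean_le => //; first exact: cst_continuous.
by move=> x; have := uC x; rewrite ler_norml => /andP[].
Qed.

Lemma measurable_sphere_act (A : orthogonal_group R n.+1) :
  measurable_fun [set: T] (sphere_act A : T -> T).
Proof.
apply: (measurability _ (erefl : @measurable _ T = <<s open >>)) => _ [U oU <-].
rewrite setTI; apply: sub_sigma_algebra.
by have /continuousP := @sphere_act_continuous _ _ A; apply.
Qed.

Lemma mean_act A u : continuous u -> mean (fun x => u (sphere_act A x)) = mean u.
Proof.
move=> cu; rewrite /mean /Rintegral; congr fine.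
rewrite -(@integral_pushforward _ _ _ _ _ _ (measurable_sphere_act A) sigma setT (EFin \o u)) //.
- apply: eq_measure_integral; first exact: (measurable_sphere_act A).
  by move=> mA B mB _; exact: (sigma_inv A mB).
- by apply/measurable_realfun.measurable_EFinP; exact: measurable_continuous.
- rewrite preimage_setT.
  apply: (@sphere_integrable (u \o sphere_act A)) => x; apply: continuous_comp.
    exact: sphere_act_continuous.
  exact: cu.
Qed.

Definition cap (d : R) y : set T := [set x | 1 - d < dot x y].

Lemma open_cap d y : open (cap d y : set X).
Proof.
have /continuousP := @continuous_dot _ _ y.
by move=> /(_ [set t | 1 - d < t]); apply; exact: open_gt.
Qed.

Lemma measurable_cap d y : measurable (cap d y).
Proof. by apply: sub_sigma_algebra; exact: open_cap. Qed.

Lemma cap_measure d x y : sigma (cap d x) = sigma (cap d y).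
Proof.
have [A <-] := sphere_transitive x y.
rewrite -[RHS](sigma_inv A); last exact: measurable_cap.
by congr (sigma _); apply/seteqP; split => z /=; rewrite /cap /= dot_act.
Qed.

(** All caps of one size have the same measure by transitivity. If it were zero, finitely many null
    caps would cover the compact sphere, whose measure is 1. *)
Lemma cap_gt0 d y : 0 < d -> (0 < sigma (cap d y))%E.
Proof.
move=> d0; rewrite lt_neqAle measure_ge0 andbT eq_sym; apply/negP => /eqP s0.
have := @compact_sphere R n.+1; rewrite compact_cover => cov.
have [|x _|D _ Dcov] := cov X setT (cap d).
- by move=> x _; exact: open_cap.
- by exists x => //=; rewrite /cap /= dotxx ltrBlDr ltrDl.
have : sigma.-negligible [set: T].
  suff : sigma.-negligible (\big[setU/set0]_(x <- D) cap d x).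
    apply: negligibleS.
    by move=> x /Dcov [z zD xz]; rewrite -bigcup_seq; exists z.
  elim/big_ind: _ => [||x _]; [exact: negligible_set0 | exact: negligibleU |].
  by apply/negligibleP; [exact: measurable_cap | rewrite /= (cap_measure d x y)].
move/negligibleP => /(_ measurableT); rewrite [X in X = _](probability_setT sigma) => /eqP.
by rewrite onee_eq0.
Qed.

Definition peak m x y : R := ((1 + dot x y) / 2) ^+ m.

Lemma continuous_peak m y : continuous (fun x => peak m x y).
Proof.
have c1 : continuous (fun x => (1 + dot x y) / 2).
  have E : (fun x => (1 + dot x y) / 2) = (fun x => 2^-1 + 2^-1 * dot x y).
    by apply/funext => x; rewrite mulrDl mul1r mulrC [_ * dot _ _]mulrC mulrC.
  rewrite E; apply: (@continuous_real_add _ _ (fun=> 2^-1)); first exact: cst_continuous.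
  by apply: continuous_real_scale; exact: continuous_dot.
elim: m => [|m IH]; first by under eq_fun do rewrite /peak expr0; exact: cst_continuous.
under eq_fun do rewrite /peak exprS.
exact: continuous_real_mul.
Qed.

Lemma peak_ge0 m x y : 0 <= peak m x y.
Proof.
by rewrite /peak exprn_ge0 // divr_ge0 // -lerBlDl sub0r dot_geN1.
Qed.

Definition peak_mass m : R := mean (fun x => peak m x point).

Lemma peak_massE m y : mean (fun x => peak m x y) = peak_mass m.
Proof.
have [A <-] := sphere_transitive point y.
rewrite /peak_mass -(mean_act A); last exact: continuous_peak.
by apply: mean_ext => x; rewrite /peak dot_act.
Qed.

Lemma peak_mass_ge d m : 0 <= d <= 1 ->
  (1 - d / 2) ^+ m * fine (sigma (cap d point)) <= peak_mass m.
Proof.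
move=> /andP[d0 d1].
have mC := measurable_cap d point.
rewrite -(@Rintegral_cst _ _ _ sigma (cap d point)) //.
have iB := sphere_integrable (@continuous_peak m (point : X)).
have iBC : sigma.-integrable (cap d point) (EFin \o (fun x => peak m x point)).
  exact: integrableS iB.
apply: (@le_trans _ _ (\int[sigma]_(x in cap d point) peak m x point)%R).
  apply: le_Rintegral => //.
    apply: (integrableS measurableT mC) => //.
    by apply: (@sphere_integrable (fun=> _)); exact: cst_continuous.
  move=> x /= dx; rewrite /peak lerXn2r // ?nnegrE ?divr_ge0 //; first by lra.
    by rewrite -lerBlDl sub0r dot_geN1.
  by move: dx; rewrite /cap /=; lra.
rewrite Rintegral_mkcond; apply: le_Rintegral => //.
  by have /(integrable_mkcond _ mC) := iBC; rewrite restrict_EFin.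
move=> x _; rewrite patchE; case: ifP => // _; exact: peak_ge0.
Qed.

Lemma peak_mass_gt0 m : 0 < peak_mass m.
Proof.
apply: lt_le_trans (@peak_mass_ge 1 m _); last by rewrite ler01 lexx.
rewrite mulr_gt0 ?exprn_gt0 //; first lra.
rewrite fine_gt0 // cap_gt0 ?ltr01 //= .
by rewrite (le_lt_trans (probability_le1 _ (measurable_cap _ _))) ?ltry.
Qed.

(* For large [m] the kernel [peak m x] concentrates at [x], uniformly in [x]:
   its mass outside the cap of size [d] is at most [(1 - d / 2) ^ m], whereas
   its total mass is at least [c (1 - d / 4) ^ m]. *)
Lemma peak_approximation u (e : R) : continuous u -> 0 < e ->
  \forall m \near \oo, forall x,
    `|u x - (peak_mass m)^-1 * mean (fun y => peak m y x * u y)| <= e.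
Proof.
move=> cu e0.
have [d' d'0 Hd'] := uniform_continuity_dot cu (divr_gt0 e0 (ltr0n _ 2)).
have [C C0 HC] := continuous_sphere_bounded cu.
(* The truncation keeps [1 - d / 2] positive and [d / 2] in the range of [peak_mass_ge]. *)
pose d := Num.min d' 1.
have d0 : 0 < d by rewrite lt_min d'0 ltr01.
have d1 : d <= 1 by rewrite ge_min lexx orbT.
have Hd x y : 1 - d < dot x y -> `|u x - u y| < e / 2.
  move=> H; apply: Hd'; apply: le_lt_trans H.
  by rewrite lerB // /d ge_min lexx.
set c := fine (sigma (cap (d / 2) point)).
have c0 : 0 < c.
  rewrite fine_gt0 // cap_gt0 ?divr_gt0 //=.
  by rewrite (le_lt_trans (probability_le1 _ (measurable_cap _ _))) ?ltry.
pose q := (1 - d / 2) / (1 - d / 2 / 2).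
have q0 : 0 <= q by rewrite divr_ge0 //; lra.
have q1 : `|q| < 1 by rewrite ger0_norm // ltr_pdivrMr; lra.
(* With this threshold the far part [2 * C * (1 - d / 2) ^+ m] is at most half of [e * I]; the other
   half is left for the oscillation of [u] inside the cap. *)
have : \forall m \near \oo, q ^+ m < e * c / (4 * C).
  have := cvg_expr q1; move/cvgrPdist_lt => /(_ (e * c / (4 * C))) H.
  have /H : 0 < e * c / (4 * C) by rewrite divr_gt0 ?mulr_gt0.
  apply: filterS => m; rewrite sub0r normrN ger0_norm // exprn_ge0 //.
apply: filterS => m qm x.
set I := peak_mass m.
have I0 : 0 < I by exact: peak_mass_gt0.
have Ige : (1 - d / 2 / 2) ^+ m * c <= I.
  by apply: peak_mass_ge; apply/andP; split; lra.
have cb : continuous (fun y => peak m y x) by exact: continuous_peak.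
have cbu : continuous (fun y => peak m y x * u y) by exact: continuous_real_mul.
have cuc : continuous (fun y => u x * peak m y x).
  exact: continuous_real_scale.
have cN1 : continuous (fun y => -1 * (peak m y x * u y)).
  exact: continuous_real_scale.
have E : u x - I^-1 * mean (fun y => peak m y x * u y) =
    I^-1 * mean (fun y => u x * peak m y x + -1 * (peak m y x * u y)).
  rewrite meanD // !meanZ // peak_massE -/I; field; exact: lt0r_neq0.
rewrite E normrM gtr0_norm ?invr_gt0 // mulrC ler_pdivrMr //.
set D := e / 2 * I + 2 * C * (1 - d / 2) ^+ m.
have bound y : `|u x * peak m y x + -1 * (peak m y x * u y)| <=
    e / 2 * peak m y x + 2 * C * (1 - d / 2) ^+ m.
  have -> : u x * peak m y x + -1 * (peak m y x * u y) = peak m y x * (u x - u y).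
    by ring.
  have d20 : 0 <= 1 - d / 2 by lra.
  rewrite normrM (ger0_norm (peak_ge0 _ _ _)).
  have [far|near] := leP (dot x y) (1 - d).
    apply: (@le_trans _ _ ((1 - d / 2) ^+ m * (2 * C))).
      apply: ler_pM => //; first exact: peak_ge0.
        rewrite /peak lerXn2r // ?nnegrE //.
          by rewrite divr_ge0 // -lerBlDl sub0r dot_geN1.
        by rewrite dotC; lra.
      by rewrite (le_trans (ler_normB _ _)) // mulr2n mulrDl mul1r lerD.
    rewrite mulrC lerDr mulr_ge0 ?peak_ge0 //; lra.
  rewrite mulrC (le_trans (ler_wpM2r (peak_ge0 _ _ _) (ltW (Hd _ _ near)))) //.
  by rewrite lerDl mulr_ge0 ?exprn_ge0 // mulr_ge0 // ltW.
have ce2 : continuous (fun y => e / 2 * peak m y x).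
  exact: continuous_real_scale.
have cD : continuous (fun y => e / 2 * peak m y x + 2 * C * (1 - d / 2) ^+ m).
  by apply: continuous_real_add => //; exact: cst_continuous.
have cU : continuous (fun y => u x * peak m y x + -1 * (peak m y x * u y)).
  exact: continuous_real_add.
apply: (@le_trans _ _ D).
  rewrite (le_trans (le_normr_Rintegral _ (sphere_integrable cU))) //.
  have -> : D = mean (fun y => e / 2 * peak m y x + 2 * C * (1 - d / 2) ^+ m).
    rewrite meanD ?mean_cst ?meanZ ?peak_massE //; exact: cst_continuous.
  apply: mean_le => //.
  exact: continuous_real_norm.
have : (1 - d / 2) ^+ m <= e / (4 * C) * I.
  have -> : (1 - d / 2) ^+ m = q ^+ m * (1 - d / 2 / 2) ^+ m.
    by rewrite -exprMn /q divfK //; apply: lt0r_neq0; lra.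
  rewrite (le_trans (ler_wpM2r _ (ltW qm))) //; first by rewrite exprn_ge0 //; lra.
  rewrite -mulrA [c / _]mulrC [X in X <= _](_ : _ = e / (4 * C) * ((1 - d / 2 / 2) ^+ m * c)); last by ring.
  by rewrite ler_pM2l // divr_gt0 // mulr_gt0.
rewrite /D => H.
have : 2 * C * (1 - d / 2) ^+ m <= 2 * C * (e / (4 * C) * I).
  by rewrite ler_pM2l // mulr_gt0.
have -> : 2 * C * (e / (4 * C) * I) = e / 2 * I by field; apply: lt0r_neq0.
lra.
Qed.

End sphere_integral.

(** * Orthonormal bases of finite-dimensional subspaces *)

Record inner_product (R : rcfType) (V : lmodType R[i]) (ip : V -> V -> R[i]) : Prop := {
  ipDl : forall u v w, ip (u + v) w = ip u w + ip v w;
  ipZl : forall a u v, ip (a *: u) v = a * ip u v;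
  ipC : forall u v, ip v u = (ip u v)^*%R;
  ip_ge0 : forall u, 0 <= ip u u;
  ip_eq0 : forall u, ip u u = 0 -> u = 0 }.

Section hermitian.
Context {R : rcfType} {V : lmodType R[i]} {ip : V -> V -> R[i]}.
Hypothesis ipP : inner_product ip.
Implicit Types (W : set V) (u v w : V).

Lemma ip0l v : ip 0 v = 0.
Proof. by rewrite -(scale0r 0) (ipZl ipP) mul0r. Qed.

Lemma ip0r v : ip v 0 = 0.
Proof. by rewrite (ipC ipP) ip0l conjC0. Qed.

Lemma ipNl u v : ip (- u) v = - ip u v.
Proof. by rewrite -scaleN1r (ipZl ipP) mulN1r. Qed.

Lemma ipBl u v w : ip (u - v) w = ip u w - ip v w.
Proof. by rewrite (ipDl ipP) ipNl. Qed.

Lemma ipDr u v w : ip w (u + v) = ip w u + ip w v.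
Proof. by rewrite (ipC ipP) (ipDl ipP) rmorphD /= -!(ipC ipP). Qed.

Lemma ipZr a u v : ip v (a *: u) = a^*%R * ip v u.
Proof. by rewrite (ipC ipP) (ipZl ipP) rmorphM /= -(ipC ipP). Qed.

Lemma ip_suml (I : Type) (r : seq I) (F : I -> V) w :
  ip (\sum_(i <- r) F i) w = \sum_(i <- r) ip (F i) w.
Proof.
by elim: r => [|i r IH]; rewrite ?big_nil ?ip0l // !big_cons (ipDl ipP) IH.
Qed.

Lemma ip_sumr (I : Type) (r : seq I) (F : I -> V) w :
  ip w (\sum_(i <- r) F i) = \sum_(i <- r) ip w (F i).
Proof.
by elim: r => [|i r IH]; rewrite ?big_nil ?ip0r // !big_cons ipDr IH.
Qed.

Definition orthonormal_family k (o : 'I_k -> V) := forall i j, ip (o i) (o j) = (i == j)%:R.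

Definition in_span m (b : 'I_m -> V) v := exists c : 'I_m -> R[i], v = \sum_i c i *: b i.

Definition ortho_proj k (o : 'I_k -> V) v := \sum_i ip v (o i) *: o i.

Lemma ip_proj k (o : 'I_k -> V) v i : orthonormal_family o -> ip (v - ortho_proj o v) (o i) = 0.
Proof.
move=> oo; rewrite ipBl ip_suml (bigD1 i) //= big1 => [|j ji].
  by rewrite (ipZl ipP) oo eqxx mulr1 addr0 subrr.
by rewrite (ipZl ipP) oo (negbTE ji) mulr0.
Qed.

(** With more orthonormal vectors than generators, the coefficient matrix has a nonzero row in its
    kernel, hence a linear relation, which pairing with each [o l] refutes. This bound stops the
    Gram-Schmidt process and later bounds the set of degrees. *)
Lemma orthonormal_leq k m (o : 'I_k -> V) (b : 'I_m -> V) :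
  orthonormal_family o -> (forall i, in_span b (o i)) -> (k <= m)%N.
Proof.
move=> oo /choice[c oc]; rewrite leqNgt; apply/negP => mk.
pose C := \matrix_(i < k, j < m) c i j.
have : kermx C != 0.
  rewrite kermx_eq0 /row_free; apply: contraTneq mk => <-.
  by rewrite -leqNgt rank_leq_col.
move=> /rowV0Pn[v /sub_kermxP vC /eqP]; apply; apply/rowP => l; rewrite mxE.
have s0 : \sum_i v 0 i *: o i = 0.
  under eq_bigr => i _ do rewrite (oc i) scaler_sumr.
  rewrite exchange_big /= big1 // => j _.
  under eq_bigr do rewrite scalerA.
  rewrite -scaler_suml (_ : \sum_i _ = 0) ?scale0r //.
  move/rowP/(_ j): vC; rewrite !mxE => E; rewrite -[RHS]E.
  by apply: eq_bigr => i _; rewrite mxE.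
have := ip0l (o l); rewrite -s0 ip_suml (bigD1 l) //= big1 => [|i il].
  by rewrite (ipZl ipP) oo eqxx mulr1 addr0.
by rewrite (ipZl ipP) oo (negbTE il) mulr0.
Qed.

Lemma orthonormal_normalize v : v != 0 -> exists2 a : R[i], a != 0 & ip (a *: v) (a *: v) = 1.
Proof.
move=> v0; have r0 : ip v v != 0 by apply: contra v0 => /eqP/(ip_eq0 ipP)/eqP.
have s0 : sqrtc (ip v v) != 0 by rewrite sqrtc_eq0.
exists (sqrtc (ip v v))^-1; first by rewrite invr_eq0.
rewrite (ipZl ipP) ipZr fmorphV /=.
rewrite [Num.conj _]geC0_conj ?sqrtc_ge0 ?(ip_ge0 ipP) //.
have : ip v v = sqrtc (ip v v) * sqrtc (ip v v) by rewrite -expr2 sqr_sqrtc.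
by move: s0; generalize (sqrtc (ip v v)) => s s0 ->; field.
Qed.

Definition linear_subspace W := W 0 /\ forall a u v, W u -> W v -> W (a *: u + v).

Lemma subspaceD W u v : linear_subspace W -> W u -> W v -> W (u + v).
Proof. by move=> [_ WL] Wu Wv; rewrite -[u]scale1r; exact: WL. Qed.

Lemma subspaceZ W a u : linear_subspace W -> W u -> W (a *: u).
Proof. by move=> [W0 WL] Wu; rewrite -[_ *: _]addr0; exact: WL. Qed.

Lemma subspaceB W u v : linear_subspace W -> W u -> W v -> W (u - v).
Proof.
by move=> sW Wu Wv; apply: subspaceD => //; rewrite -scaleN1r; exact: subspaceZ.
Qed.

Lemma subspace_sum W (I : Type) (r : seq I) (F : I -> V) :
  linear_subspace W -> (forall i, W (F i)) -> W (\sum_(i <- r) F i).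
Proof.
move=> sW WF; elim/big_ind : _ => [|u v|//]; [exact: (proj1 sW) | exact: subspaceD].
Qed.

Lemma proj_subspace W k (o : 'I_k -> V) v :
  linear_subspace W -> (forall i, W (o i)) -> W (ortho_proj o v).
Proof.
by move=> sW Wo; apply: subspace_sum => // i; apply: subspaceZ.
Qed.

Lemma orthonormal_extend k (o : 'I_k -> V) v : orthonormal_family o ->
  (forall i, ip v (o i) = 0) -> ip v v = 1 ->
  orthonormal_family (fun i : 'I_k.+1 => oapp o v (unlift ord_max i)).
Proof.
move=> oo vo vv i l; case: (unliftP ord_max i) => [i' ->|->];
  case: (unliftP ord_max l) => [l' ->|->]; rewrite ?liftK ?unlift_none /=.
- by rewrite oo (inj_eq (@lift_inj _ _)).
- by rewrite (ipC ipP) vo conjC0 eq_sym (negbTE (neq_lift _ _)).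
- by rewrite vo (negbTE (neq_lift _ _)).
- by rewrite vv eqxx.
Qed.

Lemma orthonormal_step W k (o : 'I_k -> V) : linear_subspace W ->
  (forall i, W (o i)) -> orthonormal_family o -> ~ (forall w, W w -> w = ortho_proj o w) ->
  exists2 o' : 'I_k.+1 -> V, forall i, W (o' i) & orthonormal_family o'.
Proof.
move=> sW Wo oo /existsNP[w /not_implyP[Ww wp]].
have r0 : w - ortho_proj o w != 0 by rewrite subr_eq0; exact/eqP.
have [a a0 aa] := orthonormal_normalize r0.
exists (fun i => oapp o (a *: (w - ortho_proj o w)) (unlift ord_max i)).
  move=> i; case: unliftP => [l|] _ //=.
  by apply: subspaceZ => //; apply: subspaceB => //; exact: proj_subspace.
apply: orthonormal_extend => // i.
by rewrite (ipZl ipP) ip_proj // mulr0.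
Qed.

(** Gram-Schmidt: a family that does not yet span [W] can be extended. The fuel [j] satisfies
    [m <= k + j]; when it is used up the length is at least [m], and [orthonormal_leq] forbids a
    further extension. *)
Lemma orthonormal_basis W m (b : 'I_m -> V) : linear_subspace W ->
  (forall w, W w -> in_span b w) ->
  exists k (o : 'I_k -> V),
    [/\ forall i, W (o i), orthonormal_family o & forall w, W w -> w = ortho_proj o w].
Proof.
move=> sW Wb.
suff H j k (o : 'I_k -> V) : (m <= k + j)%N -> (forall i, W (o i)) -> orthonormal_family o ->
    exists k (o : 'I_k -> V),
      [/\ forall i, W (o i), orthonormal_family o & forall w, W w -> w = ortho_proj o w].
  by apply: (H m 0%N (fun=> 0)) => // -[].
elim: j k o => [|j IH] k o mk Wo oo.
all: have [sp|nsp] := pselect (forall w, W w -> w = ortho_proj o w); first by exists k, o.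
all: have [q Wq oq] := orthonormal_step sW Wo oo nsp.
  have := orthonormal_leq oq (fun i => Wb _ (Wq i)).
  by rewrite leqNgt ltnS -(addn0 k) mk.
by apply: (IH _ q) => //; rewrite addSnnS.
Qed.

Lemma proj_unique W k (o : 'I_k -> V) v w : linear_subspace W -> (forall i, W (o i)) ->
  orthonormal_family o -> (forall w, W w -> w = ortho_proj o w) ->
  W w -> (forall h, W h -> ip (v - w) h = 0) -> w = ortho_proj o v.
Proof.
move=> sW Wo oo Wp Ww wv; rewrite [LHS]Wp //; apply: eq_bigr => i _.
by congr (_ *: _); apply/eqP; rewrite eq_sym -subr_eq0 -ipBl wv.
Qed.

End hermitian.

Arguments orthonormal_family {R V} ip {k} o.
Arguments ortho_proj {R V} ip {k} o v.

(** * Complex-valued continuous functions *)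

Section complex_continuity.
Context {R : realType}.
Implicit Types T : topologicalType.

(** The componentwise form matches [cintegral], which integrates real and imaginary parts
    separately. *)
Definition ccontinuous T (f : T -> R[i]) :=
  continuous (fun x => complex.Re (f x)) /\ continuous (fun x => complex.Im (f x)).

Lemma Re_le_norm (z : R[i]) : `|complex.Re z| <= complex.Re `|z|.
Proof. by rewrite -lecR (le_trans (normc_ge_Re z)) // RRe_real // ger0_real. Qed.

Lemma Im_le_norm (z : R[i]) : `|complex.Im z| <= complex.Re `|z|.
Proof.
case: z => a b; rewrite normc_def /= -sqrtr_sqr ler_wsqrtr // lerDr; exact: sqr_ge0.
Qed.

Lemma norm_le_ReIm (z : R[i]) : `|z| <= (`|complex.Re z| + `|complex.Im z|)%:C.
Proof.
case: z => a b; rewrite normc_def lecR /=.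
rewrite -(@ler_pXn2r _ 2) ?nnegrE ?sqrtr_ge0 ?addr_ge0 // sqr_sqrtr ?addr_ge0 ?sqr_ge0 //.
by rewrite sqrrD !real_normK ?num_real // addrAC lerDl mulrn_wge0 // mulr_ge0.
Qed.

Lemma ccontinuousP T (f : T -> R[i]^o) : continuous f <-> ccontinuous f.
Proof.
split=> [cf|[cRe cIm]].
  split=> x; apply/cvgrPdist_lt => e e0; near=> y.
    have : `|f x - f y| < e%:C.
      by near: y; have /cvgrPdist_lt := cf x; apply; rewrite ltcR.
    rewrite -raddfB -ltcR; apply: le_lt_trans.
    rewrite (le_trans _ (normc_ge_Re _)) //.
  have : `|f x - f y| < e%:C.
    by near: y; have /cvgrPdist_lt := cf x; apply; rewrite ltcR.
  rewrite -raddfB -ltcR; apply: le_lt_trans.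
  by rewrite -[leRHS]RRe_real ?ger0_real // lecR Im_le_norm.
move=> x; apply/cvgrPdist_lt => e; rewrite ltcE /= => /andP[/eqP ie re].
have -> : e = (complex.Re e)%:C by apply/eqP; rewrite eq_complex /= ie !eqxx.
near=> y; apply: le_lt_trans (norm_le_ReIm _) _; rewrite ltcR !raddfB /=.
have H1 : `|complex.Re (f x) - complex.Re (f y)| < complex.Re e / 2.
  by near: y; have /cvgrPdist_lt := cRe x; apply; rewrite divr_gt0.
have H2 : `|complex.Im (f x) - complex.Im (f y)| < complex.Re e / 2.
  by near: y; have /cvgrPdist_lt := cIm x; apply; rewrite divr_gt0.
lra.
Unshelve. all: by end_near.
Qed.

Lemma ccontinuousD T (f g : T -> R[i]) :
  ccontinuous f -> ccontinuous g -> ccontinuous (fun x => f x + g x).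
Proof.
move=> [fR fI] [gR gI]; split; under eq_fun do rewrite raddfD /=;
  exact: continuous_real_add.
Qed.

Lemma complex_ReM (z w : R[i]) : complex.Re (z * w) =
  complex.Re z * complex.Re w + -1 * (complex.Im z * complex.Im w).
Proof. by case: z w => a b [c d] /=; rewrite mulN1r. Qed.

Lemma complex_ImM (z w : R[i]) : complex.Im (z * w) =
  complex.Re z * complex.Im w + complex.Im z * complex.Re w.
Proof. by case: z w => a b [c d] /=. Qed.

Lemma ccontinuousM T (f g : T -> R[i]) :
  ccontinuous f -> ccontinuous g -> ccontinuous (fun x => f x * g x).
Proof.
move=> [fR fI] [gR gI]; split.
  under eq_fun do rewrite complex_ReM.
  apply: continuous_real_add; first exact: continuous_real_mul.
  by apply: continuous_real_scale; exact: continuous_real_mul.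
under eq_fun do rewrite complex_ImM.
by apply: continuous_real_add; exact: continuous_real_mul.
Qed.

Lemma ccontinuous_cst T (a : R[i]) : ccontinuous (fun _ : T => a).
Proof. by split; exact: cst_continuous. Qed.

Lemma complex_Re_conj (z : R[i]) : complex.Re z^*%R = complex.Re z.
Proof. by case: z. Qed.

Lemma complex_Im_conj (z : R[i]) : complex.Im z^*%R = -1 * complex.Im z.
Proof. by case: z => a b; rewrite mulN1r. Qed.

Lemma ccontinuous_conj T (f : T -> R[i]) :
  ccontinuous f -> ccontinuous (fun x => (f x)^*%R).
Proof.
move=> [fR fI]; split.
  by under eq_fun do rewrite complex_Re_conj.
by under eq_fun do rewrite complex_Im_conj; exact: continuous_real_scale.
Qed.

Lemma ccontinuous_real T (f : T -> R) : continuous f -> ccontinuous (fun x => (f x)%:C).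
Proof. by move=> cf; split => //; exact: cst_continuous. Qed.

Lemma ccontinuous_sum T (I : Type) (r : seq I) (f : I -> T -> R[i]) :
  (forall i, ccontinuous (f i)) -> ccontinuous (fun x => \sum_(i <- r) f i x).
Proof.
move=> cf; elim: r => [|i r IH].
  under eq_fun do rewrite big_nil; exact: ccontinuous_cst.
under eq_fun do rewrite big_cons; exact: ccontinuousD.
Qed.

End complex_continuity.

Section csphere_functions.
Context {R : realType} {n : nat}.
Local Notation X := (sphere R n).
Implicit Types (f g : csphere R n).

Lemma csphere_ext f g : (forall x, f x = g x) -> f = g.
Proof. by move=> fg; apply/continuousEP => x; exact: fg. Qed.

Lemma csphere_ccontinuous f : ccontinuous (f : X -> R[i]).
Proof. by apply/ccontinuousP; exact: cts_fun. Qed.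

Definition mk_csphere (f : X -> R[i]) (cf : ccontinuous f) : csphere R n :=
  mkcts (proj2 (ccontinuousP (f : X -> R[i]^o)) cf).

Lemma mk_csphereE (f : X -> R[i]) (cf : ccontinuous f) x : mk_csphere cf x = f x.
Proof. by []. Qed.

Lemma csphereD f g x : (f + g) x = f x + g x.
Proof. by []. Qed.

Lemma csphereZ a f x : (a *: f) x = a * f x.
Proof. by []. Qed.

Lemma csphereB f g x : (f - g) x = f x - g x.
Proof. by []. Qed.

Lemma csphere_sum (I : Type) (r : seq I) (F : I -> csphere R n) x :
  (\sum_(i <- r) F i) x = \sum_(i <- r) F i x.
Proof. by elim: r => [|i r IH]; rewrite ?big_nil // !big_cons csphereD IH. Qed.

Lemma translate_sum A (I : Type) (r : seq I) (F : I -> csphere R n) :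
  translate A (\sum_(i <- r) F i) = \sum_(i <- r) translate A (F i).
Proof.
apply: csphere_ext => x; rewrite translateE !csphere_sum.
by apply: eq_bigr => i _; rewrite translateE.
Qed.

End csphere_functions.

(** * The inner product and zonal kernels *)

Section sphere_inner_product.
Context {R : realType} {n : nat}.
Variable sigma : probability (borel_sphere R n) R.
Hypothesis sigma_inv : rotation_invariant sigma.
Local Notation X := (sphere R n.+1).
Local Notation CS := (csphere R n.+1).
Local Notation E := (cintegral sigma).
Local Notation N := ComplexField.Normc.normc.
Implicit Types (f g : CS) (h k : X -> R[i]) (w : {poly R}).

Lemma cintegralD h k : ccontinuous h -> ccontinuous k ->
  E (fun x => h x + k x) = E h + E k.
Proof.
move=> [hR hI] [kR kI].
have -> : E h + E k = (mean sigma (fun x => complex.Re (h x)) + mean sigma (fun x => complex.Re (k x)))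
  +i* (mean sigma (fun x => complex.Im (h x)) + mean sigma (fun x => complex.Im (k x))) by [].
rewrite -!meanD //; congr (_ +i* _); apply: (@mean_ext _ _ sigma) => x; exact: raddfD.
Qed.

Lemma cintegralZ a h : ccontinuous h -> E (fun x => a * h x) = a * E h.
Proof.
case: a => a b [hR hI].
have -> : (a +i* b) * E h =
  (a * mean sigma (fun x => complex.Re (h x)) - b * mean sigma (fun x => complex.Im (h x)))
  +i* (a * mean sigma (fun x => complex.Im (h x)) + b * mean sigma (fun x => complex.Re (h x))).
  by [].
rewrite -mulN1r -!meanZ //; last exact: continuous_real_scale.
rewrite -!meanD //; try exact: continuous_real_scale; last first.
  by do 2 apply: continuous_real_scale.
by congr (_ +i* _); apply: (@mean_ext _ _ sigma) => x; [exact: complex_ReM | exact: complex_ImM].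
Qed.

Lemma cintegral_ext h k : h =1 k -> E h = E k.
Proof.
by move=> hk; congr (_ +i* _); apply: (@mean_ext _ _ sigma) => x; rewrite hk.
Qed.

Lemma cintegral0 : E (fun=> 0) = 0.
Proof.
rewrite -[RHS](mul0r (E (fun=> 0))) -cintegralZ; last exact: ccontinuous_cst.
by apply: cintegral_ext => x; rewrite mul0r.
Qed.

Lemma cintegral_sum (I : Type) (r : seq I) (h : I -> X -> R[i]) :
  (forall i, ccontinuous (h i)) ->
  E (fun x => \sum_(i <- r) h i x) = \sum_(i <- r) E (h i).
Proof.
move=> hc; elim: r => [|i r IH].
  by rewrite big_nil -[RHS]cintegral0; apply: cintegral_ext => x; rewrite big_nil.
rewrite big_cons -IH -cintegralD //; last exact: ccontinuous_sum.
by apply: cintegral_ext => x; rewrite big_cons.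
Qed.

Lemma cintegral_conj h : ccontinuous h -> E (fun x => (h x)^*%R) = (E h)^*%R.
Proof.
move=> [hR hI]; rewrite [RHS]/Num.conj /= -mulN1r -(meanZ sigma _ hI).
congr (_ +i* _); apply: (@mean_ext _ _ sigma) => x; [exact: complex_Re_conj | exact: complex_Im_conj].
Qed.

Lemma cintegral_act A h : ccontinuous h -> E (fun x => h (sphere_act A x)) = E h.
Proof.
move=> [hR hI]; congr (_ +i* _).
  exact: (mean_act sigma_inv A hR).
exact: (mean_act sigma_inv A hI).
Qed.

Lemma normcE_norm (z : R[i]) : (N z)%:C = `|z|.
Proof. by []. Qed.

Lemma normc_ge0 (z : R[i]) : 0 <= N z.
Proof. by case: z => a b; exact: sqrtr_ge0. Qed.

(** The factor 2 comes from bounding the two parts separately; the applications only ask for some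
    constant. *)
Lemma cintegral_norm_le h (C : R) : ccontinuous h -> (forall x, N (h x) <= C) ->
  N (E h) <= 2 * C.
Proof.
move=> [hR hI] hC; rewrite -lecR normcE_norm (le_trans (norm_le_ReIm _)) // lecR.
rewrite mulr2n mulrDl mul1r lerD //=; apply: (@mean_norm_le _ _ sigma) => // x.
  exact: le_trans (Re_le_norm _) (hC x).
exact: le_trans (Im_le_norm _) (hC x).
Qed.

Definition l2_ip f g : R[i] := l2_inner sigma f g.

Local Notation ip := l2_ip.

Lemma ccontinuous_ip f g : ccontinuous (fun x => f x * (g x)^*%R).
Proof.
apply: ccontinuousM; first exact: csphere_ccontinuous.
by apply: ccontinuous_conj; exact: csphere_ccontinuous.
Qed.

(** Definiteness of the inner product rests on this. As the peak kernel lies between 0 and 1, its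
    integral against [u] is squeezed between 0 and the mean of [u], so the approximate identity
    yields [u x <= e] for every [e > 0]. *)
Lemma continuous_zero_of_mean0 (u : X -> R) : continuous u -> (forall x, 0 <= u x) ->
  mean sigma u = 0 -> forall x, u x = 0.
Proof.
move=> cu u0 mu0 x; apply/eqP; rewrite eq_le u0 andbT; apply/ler_addgt0Pl => e e0.
have [m _ /(_ m (leqnn m))/(_ x)] := peak_approximation sigma_inv cu e0.
have cbu : continuous (fun y => peak m y x * u y).
  by apply: continuous_real_mul => //; exact: continuous_peak.
have -> : mean sigma (fun y => peak m y x * u y) = 0.
  apply/eqP; rewrite eq_le; apply/andP; split.
    rewrite -mu0; apply: mean_le => // y; rewrite ler_piMl // /peak exprn_ile1 //.
      by rewrite divr_ge0 // -lerBlDl sub0r dot_geN1.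
    by have := dot_le1 y x; lra.
  apply: Rintegral_ge0 => y _; apply: mulr_ge0 => //; exact: peak_ge0.
by rewrite mulr0 subr0 ger0_norm // addr0.
Qed.

Lemma mulcJE (z : R[i]) : z * z^*%R = (complex.Re z ^+ 2 + complex.Im z ^+ 2)%:C.
Proof. by rewrite add_Re2_Im2 sqr_normc. Qed.

Lemma l2_inner_product : inner_product ip.
Proof.
split.
- move=> f g h; rewrite /ip /l2_inner -cintegralD; try exact: ccontinuous_ip.
  by apply: cintegral_ext => x; rewrite -mulrDl.
- move=> a f g; rewrite /ip /l2_inner -cintegralZ; try exact: ccontinuous_ip.
  by apply: cintegral_ext => x; rewrite csphereZ mulrA.
- move=> f g; rewrite /ip /l2_inner -cintegral_conj; try exact: ccontinuous_ip.
  by apply: cintegral_ext => x; rewrite rmorphM /= conjCK mulrC.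
- move=> f; rewrite /ip /l2_inner lecE /=; apply/andP; split.
    apply/eqP; rewrite -[RHS](mean_cst sigma 0); apply: (@mean_ext _ _ sigma) => x.
    by rewrite mulcJE.
  apply: Rintegral_ge0 => x _; rewrite mulcJE /=; exact: addr_ge0 (sqr_ge0 _) (sqr_ge0 _).
- move=> f /(congr1 (@complex.Re R)) f0; apply: csphere_ext => x.
  have := @continuous_zero_of_mean0 _ (proj1 (ccontinuous_ip f f)).
  move=> /(_ _ f0 x); rewrite mulcJE /= => H.
  have /eqP : complex.Re (f x) ^+ 2 + complex.Im (f x) ^+ 2 = 0.
    by apply: H => y; rewrite mulcJE /=; exact: addr_ge0 (sqr_ge0 _) (sqr_ge0 _).
  rewrite paddr_eq0 ?sqr_ge0 // !sqrf_eq0 => /andP[/eqP a /eqP b].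
  by apply/eqP; rewrite eq_complex a b /= !eqxx.
Qed.

Lemma ip_translate A f g : ip (translate A f) (translate A g) = ip f g.
Proof.
exact: (@cintegral_act (orthogonal_inv A) (fun x => f x * (g x)^*%R) (ccontinuous_ip f g)).
Qed.

Lemma csphere_bounded f : exists2 C : R, 0 < C & forall x, N (f x) <= C.
Proof.
have [fR fI] := csphere_ccontinuous f.
have [C C0 HC] := continuous_sphere_bounded fR.
have [D D0 HD] := continuous_sphere_bounded fI.
exists (C + D) => [|x]; first exact: addr_gt0.
rewrite -lecR normcE_norm (le_trans (norm_le_ReIm _)) // lecR; exact: lerD.
Qed.

Lemma le_supnorm f x : N (f x) <= supnorm f.
Proof.
have [C C0 HC] := csphere_bounded f.
apply: ub_le_sup; last by exists x.
by exists C => _ [y _ <-].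
Qed.

Lemma supnorm_le f (C : R) : (forall x, N (f x) <= C) -> supnorm f <= C.
Proof.
move=> HC; apply: ge_sup; first by exists (N (f point)), point.
by move=> _ [y _ <-].
Qed.

Lemma ip_norm_le f g (C D : R) : (forall x, N (f x) <= C) -> (forall x, N (g x) <= D) ->
  N (ip f g) <= 2 * (C * D).
Proof.
move=> fC gD; apply: cintegral_norm_le => [|x]; first exact: ccontinuous_ip.
rewrite ComplexField.Normc.normcM ler_pM ?normc_ge0 //.
rewrite -lecR normcE_norm; have -> : `|(g x)^*%R| = `|g x| by exact: normcJ.
by rewrite -normcE_norm lecR.
Qed.

Lemma continuous_poly_dot w (y : X) : continuous (fun x : X => w.[dot x y]).
Proof.
elim/poly_ind: w => [|w c IH].
  by under eq_fun do rewrite horner0; exact: cst_continuous.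
under eq_fun do rewrite hornerMXaddC.
apply: continuous_real_add; last exact: cst_continuous.
by apply: continuous_real_mul => //; exact: continuous_dot.
Qed.

Definition zonal w (y : X) : CS :=
  mk_csphere (ccontinuous_real (@continuous_poly_dot w y)).

Lemma zonalE w y x : zonal w y x = (w.[dot x y])%:C.
Proof. by []. Qed.

Lemma zonalC w x y : zonal w y x = zonal w x y.
Proof. by rewrite !zonalE dotC. Qed.

Lemma translate_zonal w A y : translate A (zonal w y) = zonal w (sphere_act A y).
Proof. by apply: csphere_ext => x; rewrite translateE !zonalE dot_act_inv. Qed.

(** A polynomial in <x, y> is a polynomial in the coordinates of both points. The induction is
    Horner's scheme: multiplication by <x, y> replaces each pair by one pair per coordinate, and the
    constant term adds one more. *)
Lemma zonal_separable w : exists s : seq (CS * CS),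
  forall y, zonal w y = \sum_(p <- s) p.2 y *: p.1.
Proof.
pose mul f g : CS := mk_csphere (ccontinuousM (csphere_ccontinuous f) (csphere_ccontinuous g)).
pose coord i : CS := mk_csphere (ccontinuous_real (@continuous_coordinate R n.+1 i)).
pose cst (c : R[i]) : CS := mk_csphere (ccontinuous_cst X c).
elim/poly_ind: w => [|w c [s IH]].
  by exists [::] => y; apply: csphere_ext => x; rewrite zonalE horner0 big_nil.
exists ((cst 1, cst c%:C) ::
  [seq (mul p.1 (coord i), mul p.2 (coord i)) | p <- s, i <- enum 'I_n.+1]) => y.
apply: csphere_ext => x.
rewrite zonalE hornerMXaddC rmorphD rmorphM /= -zonalE IH big_cons csphereD csphereZ /=.
rewrite mulr1 addrC; congr (_ + _).
rewrite !csphere_sum big_allpairs_dep mulr_suml; apply: eq_bigr => p _ /=.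
rewrite /dot rmorph_sum mulr_sumr /= big_enum /=; apply: eq_bigr => i _.
rewrite rmorphM [RHS](_ : _ = p.2 y * (sphere_val y i 0)%:C * (p.1 x * (sphere_val x i 0)%:C)) // csphereZ /=; ring.
Qed.

(* As the kernel is separable, the integral operator with kernel
   [w.[dot x z]] commutes with every linear form, continuous or not. *)
Lemma zonal_operator w h : ccontinuous h -> exists g : CS,
  forall L : {scalar CS}, ccontinuous (fun z => L (zonal w z)) /\
    L g = E (fun z => L (zonal w z) * h z).
Proof.
move=> ch; have [s Hs] := zonal_separable w.
have cph (p : CS * CS) : ccontinuous (fun z => p.2 z * h z).
  by apply: ccontinuousM => //; exact: csphere_ccontinuous.
exists (\sum_(p <- s) E (fun z => p.2 z * h z) *: p.1) => L.
have LE z : L (zonal w z) = \sum_(p <- s) L p.1 * p.2 z.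
  by rewrite Hs linear_sum; apply: eq_bigr => p _; rewrite linearZ /= mulrC.
split.
  under eq_fun do rewrite LE.
  apply: ccontinuous_sum => p; apply: ccontinuousM; last exact: csphere_ccontinuous.
  exact: ccontinuous_cst.
rewrite linear_sum.
under [RHS]cintegral_ext => z do rewrite LE mulr_suml.
rewrite cintegral_sum => [|p].
  apply: eq_bigr => p _; rewrite linearZ /= mulrC -cintegralZ //.
  by apply: cintegral_ext => z; rewrite mulrA.
under eq_fun do rewrite -mulrA.
by apply: ccontinuousM => //; exact: ccontinuous_cst.
Qed.

(** Evaluation is named as a linear form so that [zonal_operator] also gives the pointwise values of
    [g]. *)
Definition sphere_eval (x : X) f : R[i] := f x.

Fact sphere_eval_is_linear x : scalar (sphere_eval x).
Proof. by []. Qed.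

HB.instance Definition _ (x : X) := GRing.isLinear.Build R[i] CS R[i] *%R
  (sphere_eval x) (sphere_eval_is_linear x).

(** Totality of the zonal functions, in dual form. The integral of [f] against a peak kernel is
    killed by [L], which passes under the integral, and after normalization it is uniformly close to
    [f]. *)
Lemma zonal_dense (L : {scalar CS}) (M : R) :
  (forall f (C : R), (forall x, N (f x) <= C) -> N (L f) <= M * C) ->
  (forall w z, L (zonal w z) = 0) -> forall f, L f = 0.
Proof.
move=> LM L0 f; apply: ComplexField.Normc.eq0_normc.
apply/eqP; rewrite eq_le normc_ge0 andbT; apply/ler_addgt0Pl => e e0.
rewrite addr0.
(* The 2 pays for the real and imaginary parts; the absolute value and the 1 keep the divisor
   positive whatever [M] is. *)
pose e' := e / (2 * (`|M| + 1)).
have e'0 : 0 < e' by rewrite divr_gt0 // mulr_gt0 // ltr_wpDl.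
have [fR fI] := csphere_ccontinuous f.
have [m HR HI] : exists2 m,
    forall x, `|complex.Re (f x) - (peak_mass sigma m)^-1 *
      mean sigma (fun y => peak m y x * complex.Re (f y))| <= e' &
    forall x, `|complex.Im (f x) - (peak_mass sigma m)^-1 *
      mean sigma (fun y => peak m y x * complex.Im (f y))| <= e'.
  have [m1 _ H1] := peak_approximation sigma_inv fR e'0.
  have [m2 _ H2] := peak_approximation sigma_inv fI e'0.
  by exists (maxn m1 m2); [apply: H1; exact: leq_maxl | apply: H2; exact: leq_maxr].
pose w : {poly R} := (2^-1%:P * (1 + 'X)) ^+ m.
have wE x z : w.[dot x z] = peak m z x.
  by rewrite /w horner_exp !hornerE /= /peak dotC mulrC.
have [g Hg] := zonal_operator w (csphere_ccontinuous f).
pose c := (peak_mass sigma m)^-1.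
have gR x : complex.Re (g x) = mean sigma (fun y => peak m y x * complex.Re (f y)).
  rewrite -[g x]/(sphere_eval x g) (proj2 (Hg _)) /=.
  apply: (@mean_ext _ _ sigma) => z; rewrite complex_ReM /= wE.
  by rewrite mul0r mulr0 addr0.
have gI x : complex.Im (g x) = mean sigma (fun y => peak m y x * complex.Im (f y)).
  rewrite -[g x]/(sphere_eval x g) (proj2 (Hg _)) /=.
  apply: (@mean_ext _ _ sigma) => z; rewrite complex_ImM /= wE.
  by rewrite mul0r addr0.
have Lg : L g = 0.
  rewrite (proj2 (Hg L)) -[RHS]cintegral0; apply: cintegral_ext => z.
  by rewrite L0 mul0r.
have -> : L f = L (f - c%:C *: g) by rewrite linearB linearZ /= Lg mulr0 subr0.
apply: (@le_trans _ _ (M * (2 * e'))).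
  apply: LM => x; rewrite -lecR normcE_norm (le_trans (norm_le_ReIm _)) // lecR.
  rewrite csphereB csphereZ !raddfB /= complex_ReM complex_ImM /= gR gI mul0r mulr0 mul0r !addr0.
  by rewrite mulr2n mulrDl mul1r; exact: lerD (HR x) (HI x).
apply: (@le_trans _ _ (`|M| * (2 * e'))).
  by rewrite ler_wpM2r ?ler_norm // mulr_ge0 // ltW.
have -> : `|M| * (2 * e') = e * (`|M| / (`|M| + 1)).
  by rewrite /e'; field; rewrite lt0r_neq0 // ltr_wpDl.
by rewrite ger_pMr // ler_pdivrMr ?mul1r ?lerDl // ltr_wpDl.
Qed.

End sphere_inner_product.

(** * Spherical harmonics *)

Section harmonic_space.
Context {R : realType} {n : nat}.
Local Notation X := (sphere R n).
Local Notation CS := (csphere R n).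
Implicit Types (p q : mpoly.mpoly n R[i]) (d : nat).

Definition sphere_coords (x : X) : 'I_n -> R[i] := fun i => (sphere_val x i 0)%:C.

Lemma laplacian_is_linear a p q :
  laplacian (a *: p + q) = a *: laplacian p + laplacian q.
Proof.
rewrite /laplacian scaler_sumr -big_split /=; apply: eq_bigr => i _.
by rewrite !mpoly.mderivD !mpoly.mderivZ.
Qed.

Lemma harmonics_subspace d : linear_subspace (@harmonics R n d).
Proof.
split=> [|a f g [p [hp lp fp]] [q [hq lq gq]]].
  exists 0; split; [exact: mpoly.dhomog0 | | by move=> x; rewrite mpoly.meval0].
  by rewrite /laplacian big1 // => i _; rewrite !mpoly.mderiv0.
exists (a *: p + q); split.
- by apply: mpoly.dhomogD => //; exact: mpoly.dhomogZ.
- by rewrite laplacian_is_linear lp lq scaler0 addr0.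
- by move=> x; rewrite mpoly.mevalD mpoly.mevalZ csphereD csphereZ fp gq.
Qed.

Lemma harmonics_translate d (A : orthogonal_group R n) f :
  harmonics d f -> harmonics d (translate A f).
Proof.
move=> [p [hp lp fp]].
pose B : 'M[R[i]]_n := map_mx (real_complex R) (invmx (val A)).
exists (mpoly.comp_mpoly (linear_substitution B) p); split.
- exact: dhomog_linear_substitution.
- rewrite /laplacian laplacian_linear_substitution -/(laplacian p) ?lp ?mpoly.comp_mpoly0 //.
  rewrite /B matrix.map_trmx -map_mxM /= -[RHS](map_mx1 (real_complex R)); congr map_mx.
  have /eqP H := orthogonal_mx_inv (valP A).
  exact: mulmx1C.
- move=> x; rewrite translateE fp meval_linear_substitution; apply: mpoly.meval_eq => k.
  rewrite sphere_val_act mxE rmorph_sum; apply: eq_bigr => l _.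
  by rewrite rmorphM mxE.
Qed.

Lemma ccontinuous_meval p : ccontinuous (fun x : X => mpoly.meval (sphere_coords x) p).
Proof.
move: p; apply: (@mpoly_algebra_ind n R[i]) => [|i|c p q Hp Hq|p q Hp Hq].
- by under eq_fun do rewrite mpoly.meval1; exact: ccontinuous_cst.
- under eq_fun do rewrite mpoly.mevalXU.
  by apply: ccontinuous_real; exact: continuous_coordinate.
- under eq_fun do rewrite mpoly.mevalD mpoly.mevalZ.
  by apply: ccontinuousD => //; apply: ccontinuousM => //; exact: ccontinuous_cst.
- by under eq_fun do rewrite mpoly.mevalM; exact: ccontinuousM.
Qed.

(** Monomials of degree at most [d] generate. They need not be harmonic, since [in_span] does not
    ask the generators to lie in the subspace. *)
Lemma harmonics_in_span d : exists m (b : 'I_m -> CS), forall f, harmonics d f -> in_span b f.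
Proof.
pose J : finType := mpoly.bmultinom n d.+1.
pose mono (m : J) : CS := mk_csphere (ccontinuous_meval (mpoly.mpolyX R[i] m)).
exists #|J|, (fun i => mono (enum_val i)) => f [p [/mpoly.dhomogP hp _ fp]].
exists (fun i => mpoly.mcoeff (enum_val i : J) p).
apply: csphere_ext => x; rewrite fp.
have sp : (mpoly.msize p <= d.+1)%N.
  rewrite mpoly.msizeE; apply/bigmax_leqP_seq => m mp _.
  by rewrite ltnS -(hp m mp).
rewrite {1}(mpoly.mpolywE sp) (raddf_sum (mpoly.meval _)) /= csphere_sum.
rewrite (reindex (@enum_val J predT)) /=; last by apply: onW_bij; exact: enum_val_bij.
by apply: eq_bigr => i _; rewrite mpoly.mevalZ csphereZ mk_csphereE.
Qed.

End harmonic_space.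

(** * Zonal harmonics *)

Section zonal_harmonics.
Context {R : realType} {n : nat}.
Local Notation X := (sphere R n.+2).
Local Notation CS := (csphere R n.+2).
Implicit Types (p q : mpoly.mpoly n.+2 R[i]) (d : nat).

Definition gegen d : {poly R} := @gegenbauer n R d.

Definition zonal_harmonic d (y : X) : CS := zonal (gegen d) y.

(** The recursion has rational coefficients, so its real and complex solutions agree. The real one
    serves as a zonal kernel, the complex one in [harmonics]. *)
Lemma map_gegenbauer d : map_poly (real_complex R) (gegen d) = @gegenbauer n R[i] d.
Proof.
apply/polyP => m; rewrite coef_map !coef_poly; case: ifP => // _.
move: (d - m)%N => k; elim/ltn_ind: k => -[|[|k]] IH //=.
rewrite !(rmorphM, rmorphN, fmorphV) /= !rmorph_nat IH //.
Qed.

Lemma zonal_harmonicE d y x : zonal_harmonic d y x = (@gegenbauer n R[i] d).[(dot x y)%:C].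
Proof. by rewrite -map_gegenbauer horner_map. Qed.

Lemma sphere_coords_sumsq (y : X) : \sum_i sphere_coords y i ^+ 2 = 1.
Proof.
rewrite -[RHS](rmorph1 (real_complex R)) -(sphere_sumsq y) rmorph_sum.
by apply: eq_bigr => i _; rewrite rmorphXn.
Qed.

Lemma dot_coords (x y : X) : \sum_i sphere_coords y i * sphere_coords x i = (dot x y)%:C.
Proof.
rewrite rmorph_sum; apply: eq_bigr => i _.
by rewrite rmorphM mulrC.
Qed.

Lemma zonal_harmonic_in d y : harmonics d (zonal_harmonic d y).
Proof.
have y1 := sphere_coords_sumsq y.
have pG := @parity_gegenbauer n R[i] d.
exists (homogenization (sphere_coords y) d (@gegenbauer n R[i] d)); split.
- exact: dhomog_homogenization.
- rewrite /laplacian laplacian_homogenization // big1 // => m _.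
  by rewrite gegenbauer_coef0 ?scale0r // -ltnS.
- move=> x; rewrite zonal_harmonicE -/(sphere_coords x) meval_homogenization //.
    by rewrite dot_coords.
  exact: sphere_coords_sumsq.
Qed.

(* [gegen d] has degree exactly [d], so that these polynomials span {poly R}. *)
Lemma zonal_harmonics_span (L : {scalar CS}) :
  (forall d y, L (zonal_harmonic d y) = 0) -> forall w y, L (zonal w y) = 0.
Proof.
move=> L0 w y.
have [k] := ubnP (size w); elim: k w => // k IH w; rewrite ltnS => sw.
case: k IH sw => [|k] IH sw.
  have -> : zonal w y = 0.
    apply: csphere_ext => x; move: sw; rewrite leqn0 size_poly_eq0 => /eqP ->.
    by rewrite zonalE horner0.
  by rewrite linear0.
pose w' := w - w`_k *: gegen k.
have -> : zonal w y = zonal w' y + (w`_k)%:C *: zonal_harmonic k y.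
  apply: csphere_ext => x; rewrite csphereD csphereZ !zonalE /w' /=.
  by rewrite -rmorphM -rmorphD /= !hornerE subrK.
rewrite linearD linearZ /= L0 mulr0 addr0; apply: IH.
rewrite ltnS; apply/leq_sizeP => j kj; rewrite /w' /= coefB coefZ.
have [<-|kj'] := eqVneq k j; first by rewrite coef_gegenbauer mulr1 subrr.
have kltj : (k < j)%N by rewrite ltn_neqAle kj' kj.
rewrite parity_gegenbauer ?kltj // mulr0 subr0.
by move/leq_sizeP: sw; apply.
Qed.

(** A great circle through the pole; every value of the scalar product with the pole is attained on
    it. *)
Definition circle_vec (t s : R) : 'cV[R]_n.+2 :=
  \col_i (if i == 0 then t else if i == 1 then s else 0).

Lemma circle_vec_sphere (t s : R) : t ^+ 2 + s ^+ 2 = 1 ->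
  circle_vec t s \in @unit_sphere R n.+2.
Proof.
move=> ts; rewrite inE /unit_sphere /norm2 /=.
rewrite !big_ord_recl big1 /= => [|i _]; last by rewrite mxE /= expr0n.
by rewrite !mxE /= addr0 ts sqrtr1.
Qed.

Definition circle_point (t s : R) (ts : t ^+ 2 + s ^+ 2 = 1) : X :=
  exist (fun y => y \in @unit_sphere R n.+2) _ (circle_vec_sphere ts).

Definition pole : X := point.

Lemma dot_pole (x : X) : dot x pole = sphere_val x 0 0.
Proof.
rewrite /dot (bigD1 0) //= big1 => [|i i0]; first by rewrite mxE !eqxx mulr1 addr0.
by rewrite mxE (negbTE i0) mulr0.
Qed.

Lemma circle_exists (t : R) : -1 <= t <= 1 -> exists s, t ^+ 2 + s ^+ 2 = 1.
Proof.
move=> /andP[t1 t2]; exists (Num.sqrt (1 - t ^+ 2)).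
have h : 0 <= 1 - t ^+ 2.
  by rewrite (_ : _ - _ = (1 - t) * (1 + t)); [apply: mulr_ge0; lra | ring].
by rewrite sqr_sqrtr //; ring.
Qed.

(** A convenient infinite family of latitudes, for counting roots. On a sphere of two points only 1
    and -1 would occur. *)
Lemma dot_values : exists2 v : nat -> X,
  forall k, dot (v k) pole = k.+1%:R^-1 & injective (fun k => (dot (v k) pole)%:C).
Proof.
have H k : exists v : X, dot v pole = k.+1%:R^-1.
  have [|s ts] := @circle_exists (k.+1%:R^-1).
    rewrite (le_trans _ (_ : 0 <= _)) ?invr_ge0 ?lerN10 //=.
    by rewrite invf_le1 ?ler1n.
  by exists (circle_point ts); rewrite dot_pole mxE.
have /choice[v Hv] := H; exists v => // k l; rewrite !Hv => /complexI/invr_inj/eqP.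
by rewrite eqr_nat eqSS => /eqP.
Qed.

Lemma poly_eq_on_sphere (F : {poly R[i]}) (y : X) :
  (forall x : X, F.[(dot x y)%:C] = 0) -> F = 0.
Proof.
move=> F0; have [A Ay] := sphere_transitive pole y.
have [v _ vinj] := dot_values.
apply: (poly_eq0_infinite_roots vinj) => k; apply/rootP.
by rewrite -(dot_act A) Ay.
Qed.

Lemma zonal_harmonic_neq0 d y : zonal_harmonic d y <> 0.
Proof.
move=> z0; have E : @gegenbauer n R[i] d = 0.
  by apply: (@poly_eq_on_sphere _ y) => x; rewrite -zonal_harmonicE z0.
move/(congr1 (fun F : {poly R[i]} => F`_d)): E.
by rewrite coef_gegenbauer coef0 => /eqP; rewrite oner_eq0.
Qed.

(** The polynomials are monic of their degree: for [d < e] the coefficients at [e] disagree, and for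
    [e < d] those at [d] force [c = 0], against [zonal_harmonic_neq0]. This separates the degrees in
    the proof of orthogonality. *)
Lemma zonal_harmonic_degree d e y (c : R[i]) :
  zonal_harmonic e y = c *: zonal_harmonic d y -> d = e.
Proof.
move=> ze; have E : @gegenbauer n R[i] e - c *: @gegenbauer n R[i] d = 0.
  apply: (@poly_eq_on_sphere _ y) => x.
  by rewrite !hornerE -!zonal_harmonicE ze csphereZ subrr.
have [de|ed|//] := ltngtP d e.
  move/(congr1 (fun F : {poly R[i]} => F`_e)): E; rewrite coef0 coefB coefZ.
  rewrite coef_gegenbauer parity_gegenbauer ?de // mulr0 subr0 => /eqP.
  by rewrite oner_eq0.
move/(congr1 (fun F : {poly R[i]} => F`_d)): (E); rewrite coef0 coefB coefZ.
rewrite coef_gegenbauer parity_gegenbauer ?ed // mulr1 sub0r => /eqP.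
rewrite oppr_eq0 => /eqP c0; exfalso.
by apply: (@zonal_harmonic_neq0 e y); rewrite ze c0 scale0r.
Qed.

End zonal_harmonics.

(** * Uniqueness of the zonal harmonic *)

Section zonal_uniqueness.
Context {R : realType} {n : nat}.
Local Notation X := (sphere R n.+2).
Local Notation CS := (csphere R n.+2).
Implicit Types (p q : mpoly.mpoly n.+2 R[i]) (d : nat) (m : mpoly.multinom n.+2).
Local Notation pole := (@pole R n).

Lemma parity_polyD d (F G : {poly R[i]}) a :
  parity_poly d F -> parity_poly d G -> parity_poly d (a *: F + G).
Proof. by move=> pF pG m dm; rewrite coefD coefZ pF // pG // mulr0 addr0. Qed.

Lemma parity_polyX a b : parity_poly (a + 2 * b) ('X^a * (1 - 'X^2) ^+ b : {poly R[i]}).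
Proof.
elim: b => [|b IH] m.
  rewrite expr0 mulr1 muln0 addn0 coefXn; by case: (m =P a) => [->|//]; rewrite ltnn eqxx.
rewrite exprSr mulrA mulrBr mulr1 coefB coefMXn => H.
rewrite IH; last by move: H; lia.
case: ltnP => [_|m2]; first by rewrite subr0.
by rewrite IH ?subr0 //; move: H m2; lia.
Qed.

(* The average over the reflection [x_1 |-> - x_1] of the monomial [m] on the
   circle [x_0 ^ 2 + x_1 ^ 2 = 1], as a polynomial in [x_0]. *)
Definition monomial_profile m : {poly R[i]} :=
  if ~~ odd (m (lift ord0 ord0)) && [forall i : 'I_n, m (lift ord0 (lift ord0 i)) == 0%N]
  then 'X^(m ord0) * (1 - 'X^2) ^+ (m (lift ord0 ord0))./2 else 0.

Lemma parity_monomial_profile m : parity_poly (mpoly.mdeg m) (monomial_profile m).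
Proof.
rewrite /monomial_profile; case: ifP => [/andP[/negbTE o1 /forallP o2]|_] k; last by rewrite coef0.
have -> : mpoly.mdeg m = (m ord0 + 2 * (m (lift ord0 ord0))./2)%N.
  rewrite mpoly.mdegE !big_ord_recl big1 => [|i _]; last exact/eqP.
  by move: o1; lia.
exact: parity_polyX.
Qed.

Lemma meval_circle m (t s : R) (ts : t ^+ 2 + s ^+ 2 = 1) :
  mpoly.meval (sphere_coords (circle_point ts : X)) (mpoly.mpolyX R[i] m) =
  t%:C ^+ m ord0 * s%:C ^+ m (lift ord0 ord0) *
    [forall i : 'I_n, m (lift ord0 (lift ord0 i)) == 0%N]%:R.
Proof.
rewrite mpoly.mevalX !big_ord_recl /sphere_coords /sphere_val /= !mxE /= mulrA.
congr (_ * _); case: forallP => [H|/existsNP[i /negP mi]] /=.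
  by rewrite big1 // => i _; rewrite (eqP (H i)) expr0.
by rewrite (bigD1 i) //= !mxE /= expr0n (negbTE mi) mul0r.
Qed.

(** Odd powers of [s] cancel, even ones become powers of 1 - t^2, and monomials in any further
    coordinate vanish on the circle. *)
Lemma monomial_profileE m (t s : R) (ts : t ^+ 2 + s ^+ 2 = 1)
    (ts' : t ^+ 2 + (- s) ^+ 2 = 1) :
  mpoly.meval (sphere_coords (circle_point ts : X)) (mpoly.mpolyX R[i] m) +
  mpoly.meval (sphere_coords (circle_point ts' : X)) (mpoly.mpolyX R[i] m) =
  2 * (monomial_profile m).[t%:C].
Proof.
rewrite !meval_circle /monomial_profile rmorphN exprNn.
case: forallP => _ /=; last by rewrite andbF !mulr0 horner0 mulr0 addr0.
rewrite !mulr1 -signr_odd andbT; case: ifP => [ev|/negbFE ->]; last first.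
  by rewrite expr1 mulN1r mulrN addrN horner0 mulr0.
have E : 1 - t%:C ^+ 2 = s%:C ^+ 2 :> R[i].
  rewrite -!rmorphXn /= -[1](rmorph1 (real_complex R)) -rmorphB /= -ts.
  by rewrite addrAC subrr add0r.
rewrite (negbTE ev) expr0 mul1r !hornerE /= E -exprM mul2n even_halfK //.
by rewrite -mulrA mulr2n mulrDl mul1r.
Qed.

(** An axial function takes the same value at [x] and at the two points of the circle with the
    latitude of [x]. Adding these two values removes the odd powers of [s] and leaves a polynomial
    in the latitude. *)
Lemma axial_polynomial d p (f : CS) :
  p \is mpoly.ishomog1 d mpoly.mdeg ->
  (forall x : X, f x = mpoly.meval (sphere_coords x) p) ->
  (forall x x' : X, dot x pole = dot x' pole -> f x = f x') ->
  exists2 F : {poly R[i]}, parity_poly d F & forall x : X, f x = F.[(dot x pole)%:C].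
Proof.
move=> /mpoly.dhomogP hp fp fx.
exists (\sum_(m <- mpoly.msupp p) mpoly.mcoeff m p *: monomial_profile m).
  rewrite big_seq; elim/big_rec : _ => [m _|m F mp pF]; first by rewrite coef0.
  by apply: parity_polyD => //; rewrite -(hp m mp); exact: parity_monomial_profile.
move=> x; have [|s ts] := @circle_exists R (dot x pole).
  by rewrite dot_geN1 dot_le1.
have ts' : dot x pole ^+ 2 + (- s) ^+ 2 = 1 by rewrite sqrrN.
have E1 : f x = f (circle_point ts) by apply: fx; rewrite [RHS]dot_pole mxE.
have E2 : f x = f (circle_point ts') by apply: fx; rewrite [RHS]dot_pole mxE.
apply: (@mulfI _ 2); first by rewrite pnatr_eq0.
rewrite mulr2n mulrDl mul1r {1}E1 {1}E2 !fp {1 2}(mpoly.mpolyE p).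
rewrite !(raddf_sum (mpoly.meval _)) -big_split horner_sum mulr_sumr /=.
apply: eq_bigr => m _; rewrite !mpoly.mevalZ hornerZ -mulrDr monomial_profileE.
exact: mulrCA.
Qed.

Lemma normalize_vector (v : 'cV[R]_n.+2) : (forall i, 0 < v i 0) ->
  exists (r : R) (x : X), r != 0 /\ forall i, v i 0 = r * sphere_val x i 0.
Proof.
move=> v0; pose s := \sum_i v i 0 ^+ 2.
have s0 : 0 < s.
  rewrite /s (bigD1 0) //= ltr_wpDr ?exprn_gt0 //.
  by apply: sumr_ge0 => i _; exact: sqr_ge0.
have r0 : Num.sqrt s != 0 by rewrite sqrtr_eq0 -ltNge.
have Sx : (Num.sqrt s)^-1 *: v \in @unit_sphere R n.+2.
  rewrite inE /unit_sphere /norm2 /=; under eq_bigr do rewrite mxE exprMn.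
  by rewrite -mulr_sumr -/s exprVn sqr_sqrtr ?ltW // mulVf ?sqrtr1 ?lt0r_neq0.
exists (Num.sqrt s), (exist (fun y => y \in @unit_sphere R n.+2) _ Sx); split => // i.
by rewrite /sphere_val /= mxE mulVKf.
Qed.

(** Homogeneity extends the equality to all positive integer vectors, which determine a polynomial.
    This is needed because harmonicity is a condition on the polynomial, while only its restriction
    to the sphere is at hand. *)
Lemma dhomog_eq_on_sphere d p q : p \is mpoly.ishomog1 d mpoly.mdeg ->
  q \is mpoly.ishomog1 d mpoly.mdeg ->
  (forall x : X, mpoly.meval (sphere_coords x) p = mpoly.meval (sphere_coords x) q) ->
  p = q.
Proof.
move=> hp hq pq; apply/eqP; rewrite -subr_eq0; apply/eqP.
apply: mpoly_eq0_meval => v v0; rewrite mpoly.mevalB.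
have [|r [x [_ vx]]] := @normalize_vector (\col_i (v i)%:R).
  by move=> i; rewrite mxE ltr0n.
have E i : (v i)%:R = r%:C * sphere_coords x i :> R[i].
  rewrite /sphere_coords -rmorphM -vx mxE /=.
  by rewrite rmorph_nat.
rewrite !(mpoly.meval_eq _ E) (meval_dhomog _ _ hp) (meval_dhomog _ _ hq) pq.
exact: subrr.
Qed.

(** The polynomial representing [f] must be the homogenization of its profile [F], so its
    harmonicity is the Gegenbauer recursion for [F]. A solution is determined by its coefficient at
    [d], here [F] minus a multiple of the monic solution having none. *)
Lemma zonal_harmonic_uniq_pole d (f : CS) : harmonics d f ->
  (forall x x' : X, dot x pole = dot x' pole -> f x = f x') ->
  exists c : R[i], f = c *: zonal_harmonic d pole.
Proof.
move=> [p [hp lp fp]] fx.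
have [F pF Ff] := axial_polynomial hp fp fx.
have y1 : \sum_i sphere_coords pole i ^+ 2 = 1 := sphere_coords_sumsq pole.
have pE : p = homogenization (sphere_coords pole) d F.
  apply: dhomog_eq_on_sphere hp (dhomog_homogenization _ pF) _ => x.
  rewrite meval_homogenization //; last exact: sphere_coords_sumsq.
  by rewrite dot_coords -Ff fp.
have LF k : (k <= d)%N -> @gegenbauer_coef n R[i] d F k = 0.
  apply: (gegenbauer_coef_eq0 y1 pF); first by rewrite -pE.
  have [v _ vinj] := @dot_values R n.
  exists (fun k => sphere_coords (v k)) => [l|]; first exact: sphere_coords_sumsq.
  by move=> a b; rewrite !dot_coords => /vinj.
pose G := F - F`_d *: @gegenbauer n R[i] d.
have G0 : G = 0.
  have pG : parity_poly d G.
    move=> k dk; rewrite coefB coefZ pF // parity_gegenbauer // mulr0 subrr //.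
  apply: (@gegenbauer_coef_uniq n _ d) => // [k kd|].
    rewrite /gegenbauer_coef !coefB !coefZ.
    have := LF k kd; have := @gegenbauer_coef0 n R[i] d k kd.
    rewrite /gegenbauer_coef => H1 H2.
    transitivity (((d - k) * (d + k + n))%:R * F`_k + (k.+2 * k.+1)%:R * F`_k.+2 -
      F`_d * (((d - k) * (d + k + n))%:R * (@gegenbauer n R[i] d)`_k +
              (k.+2 * k.+1)%:R * (@gegenbauer n R[i] d)`_k.+2)); first by ring.
    by rewrite H1 H2 mulr0 subr0.
  by rewrite coefB coefZ coef_gegenbauer mulr1 subrr.
exists F`_d; apply: csphere_ext => x; rewrite csphereZ zonal_harmonicE Ff.
by apply/eqP; rewrite -subr_eq0 -hornerZ -hornerN -hornerD -/G G0 horner0.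
Qed.

Lemma zonal_harmonic_uniq d y (f : CS) : harmonics d f ->
  (forall x x' : X, dot x y = dot x' y -> f x = f x') ->
  exists c : R[i], f = c *: zonal_harmonic d y.
Proof.
move=> hf fy; have [A Ay] := sphere_transitive pole y.
have [|x x' xx'|c fc] := @zonal_harmonic_uniq_pole d (translate (orthogonal_inv A) f).
- exact: harmonics_translate.
- by rewrite !translateE !orthogonal_inv_inv; apply: fy; rewrite -Ay !dot_act.
exists c; apply: csphere_ext => x.
have := congr1 (fun g : CS => g (sphere_act (orthogonal_inv A) x)) fc.
rewrite translateE orthogonal_inv_inv sphere_act_invK => ->.
by rewrite !csphereZ !zonal_harmonicE dot_act_inv Ay.
Qed.


End zonal_uniqueness.

(** * Invariant subspaces *)

Section invariant_subspaces.
Context {R : realType} {n : nat}.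
Variable sigma : probability (borel_sphere R n.+1) R.
Hypothesis sigma_inv : rotation_invariant sigma.
Local Notation X := (sphere R n.+2).
Local Notation CS := (csphere R n.+2).
Local Notation E := (cintegral sigma).
Local Notation N := ComplexField.Normc.normc.
Local Notation ip := (l2_ip sigma).
Implicit Types (f g h : CS) (W S : set CS) (d : nat) (A : orthogonal_group R n.+2).

Let ipP := l2_inner_product sigma_inv.

Definition ip_left h f : R[i] := ip f h.

Fact ip_left_is_linear h : scalar (ip_left h).
Proof. by move=> a f g; rewrite /ip_left (ipDl ipP) (ipZl ipP). Qed.

HB.instance Definition _ h := GRing.isLinear.Build R[i] CS R[i] *%R
  (ip_left h) (ip_left_is_linear h).

(** The form <., h> is bounded for the sup norm because [h] is bounded. Vanishing on zonal
    harmonics, it vanishes everywhere, in particular at [h]. *)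
Lemma orthogonal_all_zonal h :
  (forall d y, ip (zonal_harmonic d y) h = 0) -> h = 0.
Proof.
move=> H; apply: (ip_eq0 ipP).
have [D D0 hD] := csphere_bounded h.
apply: (@zonal_dense _ _ _ sigma_inv (ip_left h : {scalar CS}) (2 * D)).
  move=> f C fC; rewrite (_ : 2 * D * C = 2 * (C * D)); last by ring.
  exact: ip_norm_le.
by apply: zonal_harmonics_span => d y; exact: H.
Qed.

(** The generators may lie outside [W], so finite dimension passes to subspaces at no cost. *)
Definition invariant_space W :=
  [/\ linear_subspace W, orthogonal_invariant W &
      exists m (b : 'I_m -> CS), forall f, W f -> in_span b f].

Lemma invariant_spaceS W S : (forall f, W f -> S f) -> invariant_space S ->
  linear_subspace W -> orthogonal_invariant W -> invariant_space W.
Proof.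
move=> WS [_ _ [m [b Sb]]] sW iW; split => //; exists m, b => f /WS; exact: Sb.
Qed.

Lemma harmonics_invariant d : invariant_space (@harmonics R n.+2 d).
Proof.
split; [exact: harmonics_subspace | | exact: harmonics_in_span].
by move=> A _ [f fd <-]; exact: harmonics_translate.
Qed.

Lemma invariantT W A f : invariant_space W -> W f -> W (translate A f).
Proof. by move=> [_ iW _] Wf; apply: iW; exists f. Qed.

Lemma invariant_basis W : invariant_space W -> exists k (o : 'I_k -> CS),
  [/\ forall i, W (o i), orthonormal_family ip o & forall f, W f -> f = ortho_proj ip o f].
Proof. by move=> [sW _ [m [b Wb]]]; exact: (orthonormal_basis ipP sW Wb). Qed.

(** * Orthogonal projection and reproducing kernel of an invariant subspace *)

Section projection.
Variables (W : set CS) (k : nat) (o : 'I_k -> CS).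
Hypotheses (iW : invariant_space W) (Wo : forall i, W (o i))
  (oo : orthonormal_family ip o) (Wp : forall f, W f -> f = ortho_proj ip o f).
Local Notation P := (ortho_proj ip o).
Let sW : linear_subspace W. Proof. by case: iW. Qed.

Lemma projW f : W (P f).
Proof. exact: (proj_subspace (ip := ip) f sW Wo). Qed.

Lemma ip_proj_sub f h : W h -> ip (f - P f) h = 0.
Proof.
move=> /Wp ->; rewrite [X in ip _ X]/ortho_proj (ip_sumr ipP) big1 // => i _.
by rewrite (ipZr ipP) (ip_proj ipP) // mulr0.
Qed.

Lemma ip_projE f h : W h -> ip (P f) h = ip f h.
Proof.
by move=> /(ip_proj_sub f) /eqP; rewrite (ipBl ipP) subr_eq0 eq_sym => /eqP.
Qed.

Lemma translateK A : cancel (translate (orthogonal_inv A)) (@translate R n.+2 A).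
Proof.
by move=> f; apply: csphere_ext => x; rewrite !translateE orthogonal_inv_inv sphere_act_invK.
Qed.

Lemma translate0 A : translate A (0 : CS) = 0.
Proof. exact: csphere_ext. Qed.

Lemma translateB A f g : translate A (f - g) = translate A f - translate A g.
Proof. exact: csphere_ext. Qed.

(** Translation is unitary and preserves [W], so the right-hand side has the two properties that
    characterize the projection of [translate A f]. *)
Lemma proj_translate A f : P (translate A f) = translate A (P f).
Proof.
apply/esym/(proj_unique ipP sW Wo oo Wp); first by apply: invariantT => //; exact: projW.
move=> h Wh; rewrite -translateB -(translateK A h) (ip_translate sigma_inv).
by apply: ip_proj_sub; exact: invariantT.
Qed.

Lemma proj_zonalC w x y : P (zonal w y) x = P (zonal w x) y.
Proof.
apply: (invariant_kernelC (k := fun x y => P (zonal w y) x)) => A x' y'.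
by rewrite -translate_zonal proj_translate translateE sphere_actK.
Qed.

(* The kernel [P (zonal w y) x] belongs to [W] as a function of [x], hence, being
   symmetric, as a function of [y]. *)
Lemma proj_zonal_transform w h : exists2 g, W g & forall y, g y = ip (P (zonal w y)) h.
Proof.
have chh : ccontinuous (fun x => (h x)^*%R).
  by apply: ccontinuous_conj; exact: csphere_ccontinuous.
(* Called for the continuity of z |-> <w_z, o_i>, which allows integration term by term. *)
have [g0 Hg0] := zonal_operator sigma w chh.
pose c i := E (fun x => ip (zonal w x) (o i) * (h x)^*%R).
exists (\sum_i c i *: o i).
  by apply: subspace_sum => // i; apply: subspaceZ.
move=> y; rewrite csphere_sum.
transitivity (E (fun x => \sum_i o i y * (ip (zonal w x) (o i) * (h x)^*%R))).
  rewrite cintegral_sum => [|i].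
    apply: eq_bigr => i _; rewrite csphereZ mulrC -cintegralZ //.
    apply: ccontinuousM => //; exact: (proj1 (Hg0 (ip_left (o i)))).
  apply: ccontinuousM; first exact: ccontinuous_cst.
  apply: ccontinuousM => //; exact: (proj1 (Hg0 (ip_left (o i)))).
apply: cintegral_ext => x; rewrite proj_zonalC csphere_sum mulr_suml.
by apply: eq_bigr => i _; rewrite csphereZ; ring.
Qed.

Lemma zonal_transform w h : W h -> exists2 g, W g & forall y, g y = ip (zonal w y) h.
Proof.
move=> Wh; have [g Wg gE] := proj_zonal_transform w h.
by exists g => // y; rewrite gE ip_projE.
Qed.

Definition repro_kernel (y : X) : CS := \sum_i (o i y)^*%R *: o i.

Lemma repro_kernelW y : W (repro_kernel y).
Proof. by apply: subspace_sum => // i; exact: subspaceZ. Qed.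

Lemma repro_kernelE h y : W h -> ip h (repro_kernel y) = h y.
Proof.
move=> Wh; rewrite {2}(Wp Wh) (ip_sumr ipP) csphere_sum; apply: eq_bigr => i _.
by rewrite (ipZr ipP) conjCK csphereZ mulrC.
Qed.

Lemma repro_kernel_uniq y g : W g -> (forall h, W h -> ip h g = h y) -> g = repro_kernel y.
Proof.
move=> Wg gE; apply/eqP; rewrite -subr_eq0; apply/eqP/(ip_eq0 ipP).
have Wd : W (g - repro_kernel y) by apply: subspaceB => //; exact: repro_kernelW.
rewrite -[X in ip _ X]scale1r -[X in ip _ (1 *: (_ + X))]scaleN1r scale1r.
rewrite (ipDr ipP) (ipZr ipP) rmorphN1 mulN1r gE // repro_kernelE //.
exact: subrr.
Qed.

Lemma repro_kernel_act A y : repro_kernel (sphere_act A y) = translate A (repro_kernel y).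
Proof.
apply/esym/repro_kernel_uniq; first by apply: invariantT => //; exact: repro_kernelW.
move=> h Wh; rewrite -{1}(translateK A h) (ip_translate sigma_inv) repro_kernelE.
  by rewrite translateE orthogonal_inv_inv.
exact: invariantT.
Qed.

(** The reflection that exchanges [x] and [x'] fixes [y], and the kernel is equivariant. *)
Lemma repro_kernel_zonal y x x' : dot x y = dot x' y ->
  repro_kernel y x = repro_kernel y x'.
Proof.
move=> xy; have [A [Ax _ Afix]] := sphere_swap x x'.
have Ay : sphere_act A y = y by apply: Afix; rewrite dotC xy dotC.
by rewrite -Ax -{2}Ay repro_kernel_act translateE sphere_actK.
Qed.

Lemma repro_kernel_harmonic d : (forall f, W f -> harmonics d f) -> forall y,
  exists c, repro_kernel y = c *: zonal_harmonic d y.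
Proof.
move=> Wd y; apply: zonal_harmonic_uniq; first exact/Wd/repro_kernelW.
by move=> x x'; exact: repro_kernel_zonal.
Qed.

(** The kernels at other points are translates of the one at [y], and they evaluate the elements of
    [W]. *)
Lemma repro_kernel0 y : repro_kernel y = 0 -> forall f, W f -> f = 0.
Proof.
move=> K0 f Wf; apply: csphere_ext => x; have [A <-] := sphere_transitive y x.
by rewrite -repro_kernelE // repro_kernel_act K0 translate0 (ip0r ipP).
Qed.

End projection.

(** * Irreducibility, orthogonality and decomposition *)

Lemma harmonic_subspace_zonal W d : invariant_space W ->
  (forall f, W f -> harmonics d f) -> forall f, W f -> f <> 0 ->
  forall y, W (zonal_harmonic d y).
Proof.
move=> iW Wd f Wf f0 y; have [k [ o [Wo oo Wp]]] := invariant_basis iW.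
have [c Kc] := repro_kernel_harmonic iW Wo Wp Wd y.
have [c0|c0] := eqVneq c 0.
  case: f0; apply: (repro_kernel0 iW Wo Wp (y := y)) => //.
  by rewrite Kc c0 scale0r.
rewrite -[zonal_harmonic d y](scalerK c0) -Kc.
by apply: subspaceZ; [case: iW | exact: repro_kernelW].
Qed.

Lemma harmonic_orthogonal_zonal d f : harmonics d f ->
  (forall y, ip (zonal_harmonic d y) f = 0) -> f = 0.
Proof.
move=> fd f0; have iH := harmonics_invariant d.
have [k [ o [Ho oo Hp]]] := invariant_basis iH.
apply: csphere_ext => y; rewrite -(repro_kernelE Hp y fd).
have [|c ->] := repro_kernel_harmonic iH Ho Hp (d := d) _ y; first by [].
by rewrite (ipZr ipP) (ipC ipP) f0 conjC0 mulr0.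
Qed.

Lemma harmonics_irreducible W d : invariant_space W ->
  (forall f, W f -> harmonics d f) -> forall g, W g -> g <> 0 ->
  forall f, harmonics d f -> W f.
Proof.
move=> iW Wd g Wg g0 f fd; have [k [ o [Wo oo Wp]]] := invariant_basis iW.
have Wz := harmonic_subspace_zonal iW Wd Wg g0.
suff E0 : f - ortho_proj ip o f = 0 by rewrite (subr0_eq E0); apply: projW.
apply: (@harmonic_orthogonal_zonal d) => [|y].
  by apply: subspaceB => //; [exact: harmonics_subspace | apply: Wd; apply: projW].
by rewrite (ipC ipP) (ip_proj_sub oo Wp) ?conjC0.
Qed.

Lemma invariant_dichotomy S d : invariant_space S ->
  (forall f, harmonics d f -> S f) \/
  (forall y f, S f -> ip (zonal_harmonic d y) f = 0).
Proof.
move=> iS; have [k [ o [So oo Sp]]] := invariant_basis iS.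
have iH := harmonics_invariant d; have [l [q [Hq qq Hp]]] := invariant_basis iH.
pose W := [set f | S f /\ harmonics d f].
have iW : invariant_space W.
  apply: (invariant_spaceS (S := S)) => // [f []//| |].
    have [[S0 SL] _ _] := iS; have [[H0 HL] _ _] := iH.
    by split=> // a f g [Sf Hf] [Sg Hg]; split; [exact: SL | exact: HL].
  by move=> A _ [f [Sf Hf] <-]; split; apply: invariantT.
have WH f : W f -> harmonics d f by case.
have [[g [Wg g0]]|noW] := pselect (exists g, W g /\ g <> 0).
  by left=> f /(harmonics_irreducible iW WH Wg g0) [].
right=> y f Sf.
(* The function x |-> <Z_d(., x), f> is obtained twice: in [S], because [f] lies there, and in H_d,
   whose projection fixes Z_d(., x). It thus belongs to the intersection [W], which is zero. *)
have [g Sg gE] := zonal_transform iS So oo Sp (@gegen R n d) Sf.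
have [g' Hg' gE'] := proj_zonal_transform iH Hq qq Hp (@gegen R n d) f.
have gg' : g = g'.
  apply: csphere_ext => x; rewrite gE gE'.
  by rewrite -(Hp (zonal _ x)) //; exact: zonal_harmonic_in.
have g0 : g = 0.
  apply: contrapT => g0; apply: noW; exists g; split=> //; split=> //.
  by rewrite gg'.
by rewrite -gE g0.
Qed.

(** By the dichotomy for H_d, either it contains H_e, and then Z_e(., y), being zonal in H_d, is a
    multiple of Z_d(., y), so that d = e; or it is orthogonal to all Z_e(., y), and then the
    projection of [f] onto H_e vanishes. *)
Lemma harmonics_orthogonal d e f g : d != e -> harmonics d f -> harmonics e g ->
  ip f g = 0.
Proof.
move=> de fd ge; have iH := harmonics_invariant d.
have [He|Hz] := invariant_dichotomy e iH.
  have [k [ o [Ho oo Hp]]] := invariant_basis iH.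
  pose y : X := point.
  have [c zc] : exists c, zonal_harmonic e y = c *: zonal_harmonic d y.
    apply: zonal_harmonic_uniq; first by apply: He; exact: zonal_harmonic_in.
    by move=> x x' xx'; rewrite !zonalE xx'.
  by move: de; rewrite (zonal_harmonic_degree zc) eqxx.
have iE := harmonics_invariant e; have [l [q [Eq qq Ep]]] := invariant_basis iE.
rewrite -(ip_projE qq Ep f ge) (_ : ortho_proj ip q f = 0) ?(ip0l ipP) //.
apply: (@harmonic_orthogonal_zonal e) => [|y]; first exact: projW.
rewrite (ipC ipP) (ip_projE qq Ep); last exact: zonal_harmonic_in.
by rewrite (ipC ipP (zonal_harmonic e y)) Hz // !conjC0.
Qed.

Lemma invariant_accessible S : invariant_space S -> orthogonal_accessible sigma S.
Proof.
move=> iS; split; first by case: iS.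
move=> Q [[M QM] QS Qid] Qeq f; split; first exact: QS.
move=> h Sh; have [k [ o [So oo Sp]]] := invariant_basis iS.
have [D D0 hD] := csphere_bounded h.
(* The form g |-> <g - Q g, h>, bounded for the sup norm because [Q] is; it remains to see that it
   kills zonal functions. *)
pose L : {scalar CS} := ip_left h \o (idfun \- Q).
apply: (@zonal_dense _ _ _ sigma_inv L (2 * (1 + `|M|) * D)) => [g C gC|w y].
  have C0 : 0 <= C by exact: le_trans (normc_ge0 _) (gC point).
  have -> : 2 * (1 + `|M|) * D * C = 2 * ((C + `|M| * C) * D) by ring.
  apply: ip_norm_le => // x; rewrite -lecR normcE_norm.
  rewrite (le_trans (ler_normB _ _)) // rmorphD lerD //= -normcE_norm lecR //.
  rewrite (le_trans (le_supnorm _ _)) // (le_trans (QM g)) //.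
  apply: (@le_trans _ _ (`|M| * supnorm g)).
    rewrite ler_wpM2r ?ler_norm //.
    exact: le_trans (normc_ge0 _) (le_supnorm g point).
  by rewrite ler_wpM2l //; exact: supnorm_le.
rewrite /L /= /ip_left (ipBl ipP).
have [g Sg gE] := zonal_transform iS So oo Sp w Sh.
have chh : ccontinuous (fun x => (h x)^*%R).
  by apply: ccontinuous_conj; exact: csphere_ccontinuous.
have [g' Hg'] := zonal_operator sigma w chh.
have gg' : g' = g.
  apply: csphere_ext => x; rewrite gE -[LHS]/(sphere_eval x g') (proj2 (Hg' _)).
  by apply: cintegral_ext => z; rewrite /sphere_eval /= zonalC.
have Qsym x : Q (zonal w y) x = Q (zonal w x) y.
  apply: (invariant_kernelC (k := fun x y => Q (zonal w y) x)) => A x' y'.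
  by rewrite -translate_zonal Qeq translateE sphere_actK.
have -> : ip (Q (zonal w y)) h = g y.
  (* Evaluation at [y] after [Q] is a linear form, so it moves under the integral that defines
     [g']. *)
  rewrite -(Qid g Sg) -gg' -[RHS]/((sphere_eval y \o Q) g') (proj2 (Hg' _)).
  by apply: cintegral_ext => z; rewrite Qsym.
by rewrite gE subrr.
Qed.

(** Unit vectors from distinct H_d are orthonormal, so [m.+1] such degrees would exceed the [m]
    generators of [S]. *)
Lemma harmonic_components_finite S : invariant_space S ->
  finite_set [set d | forall f, harmonics d f -> S f].
Proof.
move=> [_ _ [m [b Sb]]]; apply: contrapT => /(infinite_set_fset m.+1)[D DS Dm].
have unit_harmonic d : exists f, harmonics d f /\ ip f f = 1.
  have /eqP z0 := @zonal_harmonic_neq0 R n d point.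
  have [a _ a1] := orthonormal_normalize ipP z0.
  exists (a *: zonal_harmonic d point); split=> //.
  by apply: subspaceZ; [exact: harmonics_subspace | exact: zonal_harmonic_in].
have /choice[v Hv] := unit_harmonic.
pose o (i : 'I_(#|` D|)) := v (nth 0%N D i).
have oo : orthonormal_family ip o.
  move=> i j; have [->|ij] := eqVneq i j; first exact: (proj2 (Hv _)).
  apply: harmonics_orthogonal (proj1 (Hv _)) (proj1 (Hv _)).
  by rewrite nth_uniq ?fset_uniq.
have ob i : in_span b (o i).
  by apply: Sb; apply: (DS (nth 0%N D i)) (proj1 (Hv _)); exact: mem_nth.
have := orthonormal_leq ipP oo ob.
by rewrite leqNgt; move: Dm => /= ->.
Qed.

Lemma invariant_direct_sum S : invariant_space S ->
  exists F : {fset nat}, is_direct_sum F (@harmonics R n.+2) S.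
Proof.
move=> iS; have [sS invS [m [b Sb]]] := iS.
have finF := harmonic_components_finite iS.
(* For an infinite set [fset_set] would return the empty set, whence the finiteness established
   above. *)
pose F := fset_set [set d | forall f, @harmonics R n.+2 d f -> S f].
have FS d : d \in F -> forall f, harmonics d f -> S f.
  by rewrite in_fset_set // inE.
pose T := [set f | exists g : nat -> CS,
  (forall d, d \in F -> harmonics d (g d)) /\ f = \sum_(d <- F) g d].
have TS f : T f -> S f.
  move=> [g [gd ->]]; rewrite big_seq; elim/big_ind : _ => [|u v|d dF].
  - by case: sS.
  - exact: subspaceD.
  - by apply: (FS d dF); exact: gd.
have sT : linear_subspace T.
  split.
    exists (fun=> 0); split=> [d _|]; last by rewrite big1.
    by case: (harmonics_subspace (R := R) (n := n.+2) d).
  move=> a _ _ [g [gd ->]] [g' [gd' ->]].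
  exists (fun d => a *: g d + g' d); split.
    move=> d dF; case: (harmonics_subspace (R := R) (n := n.+2) d) => _; apply.
      exact: gd.
    exact: gd'.
  by rewrite scaler_sumr -big_split.
have HT d f : d \in F -> harmonics d f -> T f.
  move=> dF fd; exists (fun e => if e == d then f else 0); split.
    move=> e _; case: eqP => [->//|_].
    by case: (harmonics_subspace (R := R) (n := n.+2) e).
  rewrite (bigD1_seq d) ?fset_uniq //= eqxx big1 ?addr0 // => e /negbTE ->.
  by [].
exists F; split=> [f|g gd g0 d dF].
  split; last exact: TS.
  move=> Sf; have [k [ o [To oo Tp]]] := orthonormal_basis ipP sT (fun w Tw => Sb w (TS w Tw)).
  suff E0 : f - ortho_proj ip o f = 0.
    by rewrite (subr0_eq E0); exact: (proj_subspace (ip := ip) f sT To).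
  have Pf : S (ortho_proj ip o f) by apply: TS; exact: (proj_subspace (ip := ip) f sT To).
  apply: orthogonal_all_zonal => d y.
  (* For [d] in [F] the zonal harmonics lie in [T], to which the residual is orthogonal. For other
     [d] the dichotomy makes them orthogonal to all of [S], which contains the residual. *)
  have [dF|dF] := boolP (d \in F).
    rewrite (ipC ipP) (ip_proj_sub oo Tp) ?conjC0 //.
    by apply: (HT d) => //; exact: zonal_harmonic_in.
  have [Hd|Hz] := invariant_dichotomy d iS.
    by move: dF; rewrite in_fset_set // notin_setE.
  by apply: Hz; exact: subspaceB.
(* Pairing the relation with [g d] leaves <g d, g d> = 0, as distinct degrees are orthogonal. *)
apply: (ip_eq0 ipP); rewrite -[RHS](ip0l ipP (g d)) -g0 (ip_suml ipP).
rewrite (bigD1_seq d) ?fset_uniq //= big_seq_cond big1 ?addr0 // => e /andP[eF ed].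
by apply: (harmonics_orthogonal ed); exact: gd.
Qed.

End invariant_subspaces.

Lemma direct_sum_invariant (R : realType) (n : nat) (F : {fset nat}) (S : set (csphere R n)) :
  is_direct_sum F (@harmonics R n) S -> orthogonal_invariant S.
Proof.
move=> [SE _] A _ [f /SE[g [gd ->]] <-]; apply/SE.
exists (fun d => translate A (g d)); split; last exact: translate_sum.
by move=> d /gd; exact: harmonics_translate.
Qed.

Lemma finite_dim_invariant (R : realType) (n : nat) (S : set (csphere R n.+2)) :
  finite_dim_subspace S -> orthogonal_invariant S -> invariant_space S.
Proof.
move=> [[S0 SL] [m [b [_ Sb]]]] iS; split=> //; last by exists m, b.
split=> [|a u v Su Sv]; first exact/set_mem.
by apply/set_mem/SL; exact/mem_set.
Qed.

Unset Implicit Arguments.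

Theorem theorem2p8 (R : realType) (n : nat)
    (sigma : probability (borel_sphere R n.+1) R)
    (sigma_inv : rotation_invariant sigma)
    (S : set (csphere R n.+2)) (S_fin : finite_dim_subspace S) :
  [<-> orthogonal_invariant S;
       orthogonal_accessible sigma S;
       exists F : {fset nat}, is_direct_sum F (@harmonics R n.+2) S].
Proof.
tfae.
- by move=> iS; apply: invariant_accessible => //; exact: finite_dim_invariant.
- by move=> [iS _]; apply: (invariant_direct_sum sigma_inv); exact: finite_dim_invariant.
- by move=> [F]; exact: direct_sum_invariant.
Qed.
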